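(* Let $G$ be a group with a presentation $\langle F_n\mid R\rangle$ having $n$ generators and $n-1$ relators, where one of the relators is a commutator in $F_n$ (that is, equals $uvu^{-1}v^{-1}$ for some $u,v\in F_n$). Then exactly one of the following occurs: (i) $G\cong\mathbb{Z}\times\mathbb{Z}$. (ii) $G$ is NARA with abelianisation $G/G'\cong\mathbb{Z}\times\mathbb{Z}$. (iii) $G$ is large. In particular, if there exists a finite index subgroup $H$ of $G$ whose abelianisation $H/H'$ is not isomorphic to $\mathbb{Z}\times\mathbb{Z}$, then $G$ is large.
   Context: $F_n$ denotes the free group on the $n$ generators of the presentation, and $G'$ is the commutator subgroup of $G$. A finitely generated group is large if it has a finite index subgroup possessing a homomorphism onto a non-abelian free group. A finitely generated group $G$ is residually abelianised if the intersection of all finite index subgroups of $G$ equals $G'$; it is NARA (non-abelian residually abelianised) if moreover it is non-abelian. *)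

(* Defs.v *)
From HB Require Import structures.
From mathcomp Require Import all_boot all_order ssralg ssrint.
From mathcomp Require Import generic_quotient.
From mathcomp Require Import boolp classical_sets cardinality.

Set Implicit Arguments.
Unset Strict Implicit.
Unset Printing Implicit Defensive.

Local Open Scope group_scope.
Local Open Scope classical_set_scope.
Local Open Scope quotient_scope.

(* A subgroup of [G : groupType] is a [groupClosed G], i.e. a boolean predicate
   closed under the group operations; since [boolp] makes every [Prop] boolean,
   this covers all subgroups. [subgroup H] is the underlying group. *)

Record subgroup (G : groupType) (H : groupClosed G) :=
  Subgroup { subgroup_val : G; _ : subgroup_val \in H }.

Section SubgroupGroup.
Variables (G : groupType) (H : groupClosed G).

HB.instance Definition _ := [isSub of subgroup H for @subgroup_val G H].
HB.instance Definition _ := [Choice of subgroup H by <:].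

Fact subgroup_closed : group_closed (fun x : G => x \in H).
Proof.
split; first exact: gpred1.
by move=> x y; apply: gpredF.
Qed.

HB.instance Definition _ :=
  SubChoice_isSubGroup.Build G (fun x : G => x \in H) (subgroup H)
    subgroup_closed.
End SubgroupGroup.

HB.mixin Record isConjClosed (G : groupType) (S : {pred G}) := {
  gpred_conj : forall x y : G, x \in S -> x ^ y \in S
}.

#[short(type="normalClosed")]
HB.structure Definition NormalClosed (G : groupType) :=
  {S of GroupClosed G S & isConjClosed G S}.

Section Quotient.
Variables (G : groupType) (N : normalClosed G).
Implicit Types x y z : G.

Definition coset_rel : rel G := fun x y => x / y \in N.

Fact coset_rel_refl : reflexive coset_rel.
Proof. by move=> x; rewrite /coset_rel mulgV gpred1. Qed.

Fact coset_rel_sym : symmetric coset_rel.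
Proof. by move=> x y; rewrite /coset_rel gpredFC. Qed.

Fact coset_rel_trans : transitive coset_rel.
Proof.
move=> y x z; rewrite /coset_rel => xy yz.
by rewrite -[x](mulgVK y) -mulgA gpredM.
Qed.

Canonical coset_equiv :=
  EquivRel coset_rel coset_rel_refl coset_rel_sym coset_rel_trans.

Definition quotient_group := {eq_quot coset_rel}.

HB.instance Definition _ : EqQuotient _ coset_rel quotient_group :=
  EqQuotient.on quotient_group.
HB.instance Definition _ := Choice.on quotient_group.

Definition quo_one := lift_cst quotient_group (1 : G).
Definition quo_mul := lift_op2 quotient_group (@mul G).
Definition quo_inv := lift_op1 quotient_group (@inv G).

Lemma pi_quoP x y : reflect (x = y %[mod quotient_group]) (x / y \in N).
Proof. exact: (@eqmodP _ coset_equiv x y). Qed.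

Lemma pi_quo_one : \pi_quotient_group 1 = quo_one.
Proof. by unlock quo_one. Qed.

Lemma repr_quo x : x / repr (\pi_quotient_group x) \in N.
Proof. by apply/pi_quoP; rewrite reprK. Qed.

Lemma pi_quo_mul : {morph \pi_quotient_group : x y / x * y >-> quo_mul x y}.
Proof.
move=> x y; unlock quo_mul; apply/pi_quoP.
set x' := repr (\pi x); set y' := repr (\pi y).
have -> : x * y / (x' * y') = (y / y') ^ x^-1 * (x / x').
  by rewrite /conjg invgK invgM !mulgA mulgVK.
by rewrite gpredM ?gpred_conj ?repr_quo.
Qed.

Lemma pi_quo_inv : {morph \pi_quotient_group : x / x^-1 >-> quo_inv x}.
Proof.
move=> x; unlock quo_inv; apply/pi_quoP; set x' := repr (\pi x).
have -> : x^-1 / x'^-1 = (x' / x) ^ x by rewrite /conjg invgK mulgVK.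
by rewrite gpred_conj// gpredFC repr_quo.
Qed.

Fact quo_mulA : associative quo_mul.
Proof.
by elim/quotW=> x; elim/quotW=> y; elim/quotW=> z; rewrite -!pi_quo_mul mulgA.
Qed.

Fact quo_mul1g : left_id quo_one quo_mul.
Proof. by elim/quotW=> x; rewrite -pi_quo_one -pi_quo_mul mul1g. Qed.

Fact quo_mulg1 : right_id quo_one quo_mul.
Proof. by elim/quotW=> x; rewrite -pi_quo_one -pi_quo_mul mulg1. Qed.

Fact quo_mulVg : left_inverse quo_one quo_inv quo_mul.
Proof.
by elim/quotW=> x; rewrite -pi_quo_inv -pi_quo_mul mulVg pi_quo_one.
Qed.

Fact quo_mulgV : right_inverse quo_one quo_inv quo_mul.
Proof.
by elim/quotW=> x; rewrite -pi_quo_inv -pi_quo_mul mulgV pi_quo_one.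
Qed.

HB.instance Definition _ := isGroup.Build quotient_group
  quo_mulA quo_mul1g quo_mulg1 quo_mulVg quo_mulgV.

End Quotient.

Section NormalClosure.
Variables (G : groupType) (A : set G).

Definition normal_closure_pred : {pred G} := fun x =>
  `[< forall N : normalClosed G, A `<=` [set` N] -> x \in N >].

Fact normal_closure1 : 1 \in normal_closure_pred.
Proof. by apply/asboolP => N _; apply: gpred1. Qed.

Fact normal_closureM : mulg_closed normal_closure_pred.
Proof.
move=> x y /asboolP Ax /asboolP Ay; apply/asboolP => N AN.
by rewrite gpredM ?Ax ?Ay.
Qed.

Fact normal_closureV : invg_closed normal_closure_pred.
Proof.
move=> x /asboolP Ax; apply/asboolP => N AN.
by rewrite gpredV Ax.
Qed.

Fact normal_closureJ (x y : G) :
  x \in normal_closure_pred -> x ^ y \in normal_closure_pred.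
Proof.
move=> /asboolP Ax; apply/asboolP => N AN.
by rewrite gpred_conj ?Ax.
Qed.

Definition normal_closure : normalClosed G := HB.pack normal_closure_pred
  (isMul1Closed.Build G normal_closure_pred normal_closure1)
  (isMulClosed.Build G normal_closure_pred normal_closureM)
  (isInvClosed.Build G normal_closure_pred normal_closureV)
  (isConjClosed.Build G normal_closure_pred normal_closureJ).

End NormalClosure.

Section Derived.
Variable G : groupType.

Definition derived_pred : {pred G} := fun x =>
  `[< forall H : groupClosed G, (forall y z : G, [~ y, z] \in H) -> x \in H >].

Fact derived1 : 1 \in derived_pred.
Proof. by apply/asboolP => H _; apply: gpred1. Qed.

Fact derivedM : mulg_closed derived_pred.
Proof.
move=> x y /asboolP Dx /asboolP Dy; apply/asboolP => H RH.
by rewrite gpredM ?Dx ?Dy.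
Qed.

Fact derivedV : invg_closed derived_pred.
Proof.
move=> x /asboolP Dx; apply/asboolP => H RH.
by rewrite gpredV Dx.
Qed.

Fact derivedJ (x y : G) : x \in derived_pred -> x ^ y \in derived_pred.
Proof.
move=> /asboolP Dx; apply/asboolP => H RH.
have -> : x ^ y = x * [~ x, y] by rewrite /commg mulVKg.
by rewrite gpredM ?Dx.
Qed.

Definition derived_subgroup : normalClosed G := HB.pack derived_pred
  (isMul1Closed.Build G derived_pred derived1)
  (isMulClosed.Build G derived_pred derivedM)
  (isInvClosed.Build G derived_pred derivedV)
  (isConjClosed.Build G derived_pred derivedJ).

End Derived.

Arguments derived_pred G _ : clear implicits.

Definition abelianisation (G : groupType) := quotient_group (derived_subgroup G).

HB.instance Definition _ (G : groupType) := Group.on (abelianisation G).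

(* The free group on [X]: reduced words in the letters [(x, b)], which stand
   for [x] if [b = false] and for [x^-1] if [b = true]. *)
Section FreeGroup.
Variable X : choiceType.
Implicit Types (a b : X * bool) (s t u : seq (X * bool)).

Definition letter_inv a : X * bool := (a.1, ~~ a.2).

Definition reduced s := sorted (fun a b => b != letter_inv a) s.

Record free_group := FreeGroup { word : seq (X * bool); _ : reduced word }.

HB.instance Definition _ := [isSub of free_group for word].
HB.instance Definition _ := [Choice of free_group by <:].

(* [push a s] is the reduced form of [a :: s], for [s] reduced. *)
Definition push a s :=
  if s is b :: s' then if b == letter_inv a then s' else a :: s else [:: a].

Definition word_mul s t := foldr push t s.
Definition word_inv s := rev (map letter_inv s).

Lemma letter_invK : involutive letter_inv.
Proof. by case=> x b; rewrite /letter_inv /= negbK. Qed.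

Lemma push_reduced a s : reduced s -> reduced (push a s).
Proof.
case: s => [|b s] //= rs; case: eqP => [_|/eqP ab]; first exact: path_sorted rs.
by rewrite /= ab.
Qed.

Lemma word_mul_reduced s t : reduced t -> reduced (word_mul s t).
Proof. by move=> rt; elim: s => //= a s IHs; apply: push_reduced. Qed.

Lemma pushK a s : reduced s -> push (letter_inv a) (push a s) = s.
Proof.
case: s => [|b s] /=; first by rewrite letter_invK eqxx.
case: eqP => [-> | _] rs; last by rewrite /= letter_invK eqxx.
case: s rs => [|c s] //= /andP[]; rewrite letter_invK.
by case: eqP.
Qed.

Lemma pushVK a s : reduced s -> push a (push (letter_inv a) s) = s.
Proof. by move=> rs; rewrite -{1}[a]letter_invK pushK. Qed.

Lemma word_mul1 s : reduced s -> word_mul s [::] = s.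
Proof.
elim: s => //= a s IHs rs; have rs' : reduced s := path_sorted rs.
rewrite (IHs rs') {IHs rs'}; by case: s rs => //= b s /andP[/negPf ->].
Qed.

Lemma word_mul_push a s t :
  reduced t -> word_mul (push a s) t = push a (word_mul s t).
Proof.
move=> rt; case: s => [|b s] //=; case: eqP => [-> | _] //=.
by rewrite pushVK// word_mul_reduced.
Qed.

Lemma word_mulA s t u :
  reduced u -> word_mul s (word_mul t u) = word_mul (word_mul s t) u.
Proof. by move=> ru; elim: s => //= a s ->; rewrite word_mul_push. Qed.

Lemma word_mulVK s t : reduced t -> word_mul (word_inv s) (word_mul s t) = t.
Proof.
move=> rt; elim: s => //= a s IHs.
rewrite /word_inv /= rev_cons -cats1 /word_mul foldr_cat /= pushK//.
exact: word_mul_reduced.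
Qed.

Lemma word_invK : involutive word_inv.
Proof. by move=> s; rewrite /word_inv map_rev revK (mapK letter_invK). Qed.

Lemma word_inv_reduced s : reduced s -> reduced (word_inv s).
Proof.
rewrite /reduced /word_inv rev_sorted sorted_map => rs.
apply: sub_sorted rs => a b /=; apply: contraNneq => ->.
by rewrite !letter_invK.
Qed.

Lemma wordP (f : free_group) : reduced (word f).
Proof. exact: valP f. Qed.

Definition free_one := @FreeGroup [::] isT.
Definition free_mul (f g : free_group) :=
  FreeGroup (word_mul_reduced (word f) (wordP g)).
Definition free_inv (f : free_group) := FreeGroup (word_inv_reduced (wordP f)).

Fact free_mulA : associative free_mul.
Proof. by move=> f g h; apply/val_inj/word_mulA/wordP. Qed.

Fact free_mul1g : left_id free_one free_mul.
Proof. by move=> f; apply: val_inj. Qed.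

Fact free_mulg1 : right_id free_one free_mul.
Proof. by move=> f; apply/val_inj/word_mul1/wordP. Qed.

Fact free_mulVg : left_inverse free_one free_inv free_mul.
Proof.
move=> f; apply: val_inj => /=.
by rewrite -{2}[word f]word_mul1 ?wordP// word_mulVK.
Qed.

Fact free_mulgV : right_inverse free_one free_inv free_mul.
Proof.
move=> f; apply: val_inj => /=.
rewrite -{1}[word f]word_invK -[X in word_mul _ X]word_mul1.
  by rewrite word_mulVK.
exact/word_inv_reduced/wordP.
Qed.

HB.instance Definition _ := isGroup.Build free_group
  free_mulA free_mul1g free_mulg1 free_mulVg free_mulgV.

End FreeGroup.

Definition ZxZ : groupType :=
  (Algebra.to_multiplicative int * Algebra.to_multiplicative int)%type.

Definition isomorphic (G K : groupType) :=
  exists f : {multiplicative G -> K}, bijective f.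

Definition abelian_group (G : groupType) := forall x y : G, commute x y.

Definition finite_index (G : groupType) (H : groupClosed G) :=
  finite_set (range (fun x : G => [set h * x | h in [set` H]])).

Definition maps_onto (G K : groupType) :=
  exists f : {multiplicative G -> K}, range f = setT.

Definition large (G : groupType) :=
  exists H : groupClosed G, finite_index H /\
    exists X : choiceType,
      ~ abelian_group (free_group X) /\ maps_onto (subgroup H) (free_group X).

Definition residually_abelianised (G : groupType) :=
  \bigcap_(H in [set H : groupClosed G | finite_index H]) [set` H]
  = [set` derived_subgroup G].

Definition nara (G : groupType) := ~ abelian_group G /\ residually_abelianised G.

(* [G] is the group [< F_n | R_0, ..., R_(m-1) >]. *)
Definition presents (n m : nat) (R : 'I_m -> free_group 'I_n) (G : groupType) :=
  isomorphic (quotient_group (normal_closure (range R))) G.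

Definition is_commutator (F : groupType) (w : F) :=
  exists u v : F, w = u * v * u^-1 * v^-1.

Definition exactly_one (P Q S : Prop) :=
  [\/ [/\ P, ~ Q & ~ S], [/\ ~ P, Q & ~ S] | [/\ ~ P, ~ Q & S]].

(* Main.v *)
Require Import Defs.
From HB Require Import structures.
From mathcomp Require Import all_boot all_order all_algebra.
From mathcomp Require Import generic_quotient perm.
From mathcomp Require Import boolp classical_sets cardinality.
From mathcomp Require Import zify.

(** Write F for the free group, pi : F -> G for the projection and
    [u, v] = u v u^-1 v^-1 for the relator that is a commutator.  The proof
    rests on one construction, [large_of_proper]: if some proper subgroup H of
    finite index contains pi u and pi v, then G is large.

    To see this, let F act on the finite set I = G / H, with base point i0.
    The presentation complex of H has n|I| edges and (n-1)|I| two-cells, the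
    lifts of the relators.  The lift of [u, v] at i0 is the commutator of two
    loops, so it is invisible to every homomorphism to an abelian group; and
    the lifts of [u, v] at all the points of I add up to zero in homology, by
    transfer.  As |I| > 1, two of the equations are thus redundant, and counting
    unknowns against equations leaves a homomorphism chi from H onto Z that
    kills u and v ([commutator_class]).  In the corresponding infinite cyclic
    cover the lifts of [u, v] over i0 are still commutators of loops, one for
    each level a in Z, so that one equation per level is redundant: the
    Alexander polynomial of chi vanishes.  Hence for M large there is a nonzero
    integral 1-cocycle on the cover, supported on M consecutive levels
    ([level_solution]): the loss at the two ends of the block is bounded,
    whereas the gain grows with M.  Copies of this cocycle at spacing m > M do
    not interact, because a relator only meets a bounded range of levels;
    labelling the edges of the j-th block by powers of s^-j y s^j therefore
    gives a labelling in the free group on y and s under which all the relators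
    are trivial.  It is compatible with the translation by m, which is sent to
    s, and so defines a homomorphism from the finite index subgroup
    { h in H | m divides chi h } onto the free group of rank 2 ([cover_large]).

    Now suppose that G is not large.  Then pi u and pi v lie in no proper
    subgroup of finite index.  In a finite permutation representation they thus
    generate the whole image, which is abelian because they commute: every
    finite index subgroup contains G' ([not_large_commutators]).  Since finitely
    generated abelian groups are subgroup separable ([abelian_separable]),
    pi u and pi v generate G / G', and G' is the intersection of the finite
    index subgroups.  A homomorphism F -> Z factors through G as soon as it
    satisfies n-2 linear conditions, so a relation between u and v in G / G'
    would allow a homomorphism from G onto Z killing both, and the preimage of
    2Z would be a proper subgroup of finite index containing them.
    Hence G / G' is free abelian on u and v ([not_large_abelianisation]).  This
    gives the first two cases, according to whether G is abelian.  If H has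
    finite index, then H is finitely generated and H' is an intersection of
    finite index subgroups of G, so that G' is contained in H'; then H / H' is a
    finite index subgroup of G / G', hence isomorphic to Z x Z
    ([not_large_finite_index]).

    Finally a large group has a finite index subgroup H with a nonabelian finite
    quotient, whose kernel does not contain G' ([large_commutator]); this
    excludes the third case when one of the first two holds. *)

Set Implicit Arguments.
Unset Strict Implicit.
Unset Printing Implicit Defensive.

Import GRing.Theory Num.Theory Order.TTheory.

Local Open Scope group_scope.
Local Open Scope classical_set_scope.

(** * Homomorphisms, subgroups and integral powers *)

Section Hom.
Variables (G K : groupType) (f : {multiplicative G -> K}).

Lemma hom_one : f 1 = 1.
Proof. by apply: (mulgI (f 1)); rewrite -gmulfM !mulg1. Qed.

Lemma hom_inv x : f x^-1 = (f x)^-1.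
Proof. by apply: (mulgI (f x)); rewrite -gmulfM !mulgV hom_one. Qed.

Lemma hom_inj : (forall x, f x = 1 -> x = 1) -> injective f.
Proof.
move=> f1 x y fxy; apply: divg1_eq; apply: f1.
by rewrite gmulfM hom_inv fxy mulgV.
Qed.

End Hom.

(** Lets a subgroup be introduced by a propositional predicate. *)
Lemma subgroup_of_closed (G : groupType) (P : G -> Prop) :
  P 1 -> (forall x y, P x -> P y -> P (x * y)) -> (forall x, P x -> P x^-1) ->
  exists H : groupClosed G, forall x, x \in H <-> P x.
Proof.
move=> P1 PM PV; pose S : {pred G} := fun x => `[< P x >].
have S1 : 1 \in S by apply/asboolP.
have SM : mulg_closed S by move=> x y /asboolP Px /asboolP Py; apply/asboolP/PM.
have SV : invg_closed S by move=> x /asboolP Px; apply/asboolP/PV.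
pose H : groupClosed G := HB.pack S (isMul1Closed.Build G S S1)
  (isMulClosed.Build G S SM) (isInvClosed.Build G S SV).
by exists H => x; split=> [/asboolP|Px] //; apply/asboolP.
Qed.

Lemma trivial_subgroup (G : groupType) :
  exists T : groupClosed G, forall x, x \in T <-> x = 1.
Proof.
by apply: subgroup_of_closed => [|_ _ -> ->|_ ->]; rewrite ?mulg1 ?invg1.
Qed.

Lemma normal_closure_min (G : groupType) (A : set G) (P : G -> Prop) :
  P 1 -> (forall x y, P x -> P y -> P (x * y)) -> (forall x, P x -> P x^-1) ->
  (forall x y, P x -> P (x ^ y)) -> (forall x, A x -> P x) ->
  forall x, x \in normal_closure A -> P x.
Proof.
move=> P1 PM PV PJ AP x; pose S : {pred G} := fun x => `[< P x >].
have S1 : 1 \in S by apply/asboolP.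
have SM : mulg_closed S by move=> y z /asboolP Py /asboolP Pz; apply/asboolP/PM.
have SV : invg_closed S by move=> y /asboolP Py; apply/asboolP/PV.
have SJ (y z : G) : y \in S -> y ^ z \in S.
  by move=> /asboolP Py; apply/asboolP/PJ.
pose H : normalClosed G := HB.pack S (isMul1Closed.Build G S S1)
  (isMulClosed.Build G S SM) (isInvClosed.Build G S SV)
  (isConjClosed.Build G S SJ).
move=> /asboolP /(_ H) xH.
suff: x \in H by move/asboolP.
by apply: xH => y Ay; apply/asboolP/AP.
Qed.

Lemma sub_normal_closure (G : groupType) (A : set G) x :
  A x -> x \in normal_closure A.
Proof. by move=> Ax; apply/asboolP => N; apply. Qed.

Lemma quo_epi (G : groupType) (N : normalClosed G) :
  exists p : {multiplicative G -> quotient_group N},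
    (forall y, exists x, p x = y) /\ (forall x, p x = 1 <-> x \in N).
Proof.
pose p0 (x : G) : quotient_group N := (\pi_(quotient_group N) x)%qT.
have p0M : {morph p0 : x y / x * y >-> x * y} by move=> x y; apply: pi_quo_mul.
pose p : {multiplicative G -> quotient_group N} :=
  HB.pack p0 (isMultiplicative.Build _ _ p0 p0M).
exists p; split=> [y|x]; first by exists (repr y); apply: reprK.
have p1 : p0 1 = 1 := hom_one p.
rewrite -[x in x \in N]divg1; split=> [px|/pi_quoP xN]; last exact: etrans xN p1.
by apply/pi_quoP; apply: (etrans px); rewrite -p1.
Qed.

Lemma presents_epi (n m : nat) (R : 'I_m -> free_group 'I_n) (G : groupType) :
  presents R G ->
  exists pi : {multiplicative free_group 'I_n -> G},
    (forall x, exists g, pi g = x) /\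
    (forall g, pi g = 1 <-> g \in normal_closure (range R)).
Proof.
case=> f f_bij; have [f' fK f'K] := f_bij.
have [p [p_surj pE]] := quo_epi (normal_closure (range R)).
have fpM : {morph f \o p : x y / x * y >-> x * y}.
  by move=> x y; rewrite /= !gmulfM.
pose pi : {multiplicative free_group 'I_n -> G} :=
  HB.pack (f \o p) (isMultiplicative.Build _ _ (f \o p) fpM).
exists pi; split=> [x|g].
  by have [g gE] := p_surj (f' x); exists g; rewrite /= gE f'K.
split=> [fpg|/pE pg]; last by rewrite /= pg hom_one.
by apply/pE; apply: (can_inj fK); rewrite hom_one.
Qed.

Definition zexp (G : groupType) (x : G) (k : int) : G :=
  match k with Posz n => x ^+ n | Negz n => x ^- n.+1 end.

Lemma zexpD (G : groupType) (x : G) (a b : int) :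
  zexp x (a + b)%R = zexp x a * zexp x b.
Proof.
have zS a' : zexp x (a' + 1)%R = zexp x a' * x.
  case: a' => n.
    have -> : (Posz n + 1)%R = Posz n.+1 by rewrite addrC -intS.
    exact: expgSr.
  case: n => [|n]; first by rewrite /= expg1 mulVg.
  have -> : (Negz n.+1 + 1)%R = Negz n by rewrite !NegzE; lia.
  by rewrite /= [x ^+ n.+2]expgS invgM mulgVK.
have zP a' : zexp x (a' - 1)%R = zexp x a' * x^-1.
  by rewrite -[in RHS](subrK 1%R a') zS mulgK.
elim/int_rect: b => [|n IHn|n IHn]; first by rewrite addr0 mulg1.
  by rewrite -addn1 PoszD addrA !zS IHn mulgA.
by rewrite -addn1 PoszD opprD addrA !zP IHn mulgA.
Qed.

Lemma zexpN (G : groupType) (x : G) (a : int) : zexp x (- a)%R = (zexp x a)^-1.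
Proof. by apply: (mulgI (zexp x a)); rewrite -zexpD subrr mulgV. Qed.

Lemma zexpM (G : groupType) (x : G) (k p : int) :
  zexp x (k * p)%R = zexp (zexp x k) p.
Proof.
elim/int_rect: p => [|p IHp|p IHp]; first by rewrite mulr0.
  by rewrite -addn1 PoszD mulrDr mulr1 !zexpD IHp.
by rewrite -addn1 PoszD opprD mulrBr mulr1 !zexpD zexpN IHp.
Qed.

Lemma hom_zexp (G K : groupType) (f : {multiplicative G -> K}) x k :
  f (zexp x k) = zexp (f x) k.
Proof.
elim/int_rect: k => [|p IHp|p IHp]; first exact: hom_one.
  by rewrite -addn1 PoszD !zexpD gmulfM IHp.
by rewrite -addn1 PoszD opprD !zexpD gmulfM IHp hom_inv.
Qed.

Lemma gpred_zexp (G : groupType) (H : groupClosed G) x k :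
  x \in H -> zexp x k \in H.
Proof. by case: k => n xH; rewrite /= ?gpredV; apply: gpredXn. Qed.

Lemma commute_zexp (G : groupType) (x y : G) a b :
  commute x y -> commute (zexp x a) (zexp y b).
Proof.
move=> xy; case: a b => a [] b /=.
- exact: commuteX2.
- exact/commuteV/commuteX2.
- by apply/commute_sym/commuteV/commuteX2/commute_sym.
- by apply/commuteV/commute_sym/commuteV/commuteX2/commute_sym.
Qed.

(** * Free groups, actions and cocycles *)

Section FreeBasics.
Variable X : choiceType.
Implicit Types g h : free_group X.

Definition gen (x : X) : free_group X :=
  @FreeGroup X [:: (x, false)] isT.

Lemma free_ind (P : free_group X -> Prop) :
  P 1 -> (forall x g, P g -> P (gen x * g)) ->
  (forall x g, P g -> P ((gen x)^-1 * g)) -> forall g, P g.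
Proof.
move=> P1 Pg PV [w rw]; elim: w rw => [|[x b] w IHw] rw.
  by have -> : FreeGroup rw = 1 by apply: val_inj.
have rw' : reduced w := path_sorted rw.
have pushE : push (x, b) w = (x, b) :: w.
  by case: w rw {IHw rw'} => //= c w /andP[/negPf ->].
case: b rw pushE => rw pushE.
  have -> : FreeGroup rw = (gen x)^-1 * FreeGroup rw'.
    by apply: val_inj; rewrite /= -pushE.
  exact/PV/IHw.
have -> : FreeGroup rw = gen x * FreeGroup rw'.
  by apply: val_inj; rewrite /= -pushE.
exact/Pg/IHw.
Qed.

Lemma free_gen_ind (P : free_group X -> Prop) :
  P 1 -> (forall g h, P g -> P h -> P (g * h)) ->
  (forall g, P g -> P g^-1) -> (forall x, P (gen x)) -> forall g, P g.
Proof.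
by move=> P1 PM PV Pg; apply: free_ind => // x g Pg'; apply: PM => //; apply: PV.
Qed.

End FreeBasics.

Definition is_action (G : groupType) (S : Type) (act : G -> S -> S) :=
  (forall s, act 1 s = s) /\ (forall g h s, act (g * h) s = act g (act h s)).

(** Cocycles are the usual device for describing homomorphisms defined on a
    stabiliser: restricted to the stabiliser of [s], the map [V ^~ s] is a
    homomorphism, and a cocycle on the free group is freely prescribed by its
    values on the generators ([free_cocycle]).  Geometrically, [V g s] is the
    label of the path that starts at [s] and reads [g]. *)
Definition is_cocycle (G : groupType) (S : Type) (act : G -> S -> S)
    (A : groupType) (V : G -> S -> A) :=
  forall g h s, V (g * h) s = V g (act h s) * V h s.

Section Actions.
Variables (G : groupType) (S : Type) (act : G -> S -> S).
Hypothesis actP : is_action act.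

Lemma act1 s : act 1 s = s. Proof. by case: actP. Qed.

Lemma actM g h s : act (g * h) s = act g (act h s). Proof. by case: actP. Qed.

Lemma actK g : cancel (act g) (act g^-1).
Proof. by move=> s; rewrite -actM mulVg act1. Qed.

Lemma actVK g : cancel (act g^-1) (act g).
Proof. by move=> s; rewrite -actM mulgV act1. Qed.

Lemma act_fixV g s : act g s = s -> act g^-1 s = s.
Proof. by move=> gs; rewrite -{1}gs actK. Qed.

Variables (A : groupType) (V : G -> S -> A).
Hypothesis VP : is_cocycle act V.

Lemma cocycle1 s : V 1 s = 1.
Proof. by apply: (mulgI (V 1 s)); rewrite -{1}(act1 s) -VP !mulg1. Qed.

Lemma cocycleV g s : V g^-1 s = (V g (act g^-1 s))^-1.
Proof.
apply: (mulgI (V g (act g^-1 s))).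
by rewrite mulgV -VP mulgV cocycle1.
Qed.

End Actions.

Lemma free_action (X : choiceType) (S : Type) (f f' : X -> S -> S) :
  (forall x, cancel (f x) (f' x)) -> (forall x, cancel (f' x) (f x)) ->
  exists act : free_group X -> S -> S,
    is_action act /\ forall x, act (gen x) =1 f x.
Proof.
move=> fK f'K.
pose step (a : X * bool) s := if a.2 then f' a.1 s else f a.1 s.
have stepK a s : step (letter_inv a) (step a s) = s.
  by case: a => x []; rewrite /step /= ?fK ?f'K.
have stepVK a s : step a (step (letter_inv a) s) = s.
  by rewrite -{1}[a]letter_invK stepK.
pose W w s := foldr step s w.
have Wpush a w s : W (push a w) s = step a (W w s).
  case: w => [|b w] //; rewrite /push; case: eqP => [-> | _] //.
  by rewrite [W (_ :: _) s]/(step _ (W w s)) stepVK.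
exists (fun g => W (word g)); split; last by [].
split=> // g h s.
by rewrite /W /=; elim: (word g) => //= a w IHw; rewrite -/(W _ _) Wpush /W IHw.
Qed.

(** The cocycle is read off from the action of the generators on [S * A] by
    [(s, a) |-> (x s, v x s * a)]; it commutes with right translations of [A]. *)
Lemma free_cocycle (X : choiceType) (S : Type) (act : free_group X -> S -> S)
    (A : groupType) (v : X -> S -> A) :
  is_action act ->
  exists V : free_group X -> S -> A,
    is_cocycle act V /\ forall x s, V (gen x) s = v x s.
Proof.
move=> actP.
pose f x (p : S * A) := (act (gen x) p.1, v x p.1 * p.2).
pose f' x (p : S * A) :=
  (act (gen x)^-1 p.1, (v x (act (gen x)^-1 p.1))^-1 * p.2).
have fK x : cancel (f x) (f' x).
  by case=> s a; rewrite /f /f' /= actK// mulKg.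
have f'K x : cancel (f' x) (f x).
  by case=> s a; rewrite /f /f' /= actVK// mulVKg.
have [sk [skP skE]] := free_action fK f'K.
have skV x p : sk (gen x)^-1 p = f' x p.
  by rewrite -{1}[p](f'K x) -skE actK.
have sk_eq g p : sk g p = (act g p.1, (sk g (p.1, 1)).2 * p.2).
  elim/free_ind: g p => [|x g IHg|x g IHg] [s a].
  - by rewrite !(act1 skP) (act1 actP) mul1g.
  - rewrite (actM skP) IHg /= skE (actM actP) (actM skP) [sk g (s, 1)]IHg.
    by rewrite skE /f /= mulg1 mulgA.
  - rewrite (actM skP) IHg /= skV (actM actP) (actM skP) [sk g (s, 1)]IHg.
    by rewrite skV /f' /= mulg1 mulgA.
exists (fun g s => (sk g (s, 1)).2); split=> [g h s|x s].
  by rewrite (actM skP) [sk h _]sk_eq sk_eq /= mulg1.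
by rewrite skE /= mulg1.
Qed.

Lemma cocycle_eq (X : choiceType) (S : Type) (act : free_group X -> S -> S)
    (A : groupType) (V W : free_group X -> S -> A) :
  is_action act -> is_cocycle act V -> is_cocycle act W ->
  (forall x s, V (gen x) s = W (gen x) s) -> forall h s, V h s = W h s.
Proof.
move=> actP VP WP VW; elim/free_ind => [|x h IHh|x h IHh] s.
- by rewrite (cocycle1 actP VP) (cocycle1 actP WP).
- by rewrite VP WP VW IHh.
- by rewrite VP WP (cocycleV actP VP) (cocycleV actP WP) VW IHh.
Qed.

(** The universal property: a cocycle over a point is a homomorphism. *)
Lemma free_hom (X : choiceType) (A : groupType) (f : X -> A) :
  exists phi : {multiplicative free_group X -> A}, forall x, phi (gen x) = f x.
Proof.
have triv : is_action (fun (_ : free_group X) (s : unit) => s) by [].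
have [V [VP VE]] := free_cocycle (fun x _ => f x) triv.
pose phi0 g := V g tt.
have phiM : {morph phi0 : x y / x * y >-> x * y} by move=> g h; apply: VP.
pose phi : {multiplicative free_group X -> A} :=
  HB.pack phi0 (isMultiplicative.Build _ _ phi0 phiM).
by exists phi => x; apply: VE.
Qed.

(** Cocycles with values in Z, in additive notation.  It is convertible to
    [is_cocycle] for the multiplicative copy of [int]. *)
Definition is_zcocycle (G : groupType) (S : Type) (act : G -> S -> S)
    (V : G -> S -> int) :=
  forall g h s, V (g * h) s = (V g (act h s) + V h s)%R.

Section ZCocycle.
Variables (G : groupType) (S : Type) (act : G -> S -> S).
Hypothesis actP : is_action act.
Variables (V : G -> S -> int).
Hypothesis VP : is_zcocycle act V.

Lemma zcocycle1 s : V 1 s = 0%R.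
Proof. exact: (@cocycle1 _ _ _ actP (Algebra.to_multiplicative int) V VP). Qed.

Lemma zcocycleV g s : V g^-1 s = (- V g (act g^-1 s))%R.
Proof. exact: (@cocycleV _ _ _ actP (Algebra.to_multiplicative int) V VP). Qed.

End ZCocycle.

(** A commutator of two loops has label zero in an abelian group. *)
Lemma zcocycle_commutator (G : groupType) (S : Type) (act : G -> S -> S)
    (V : G -> S -> int) (u v : G) (s : S) :
  is_action act -> is_zcocycle act V -> act u s = s -> act v s = s ->
  V (u * v * u^-1 * v^-1) s = 0%R.
Proof.
move=> actP VP us vs; have uVs := act_fixV actP us; have vVs := act_fixV actP vs.
rewrite !VP vVs uVs vs !(zcocycleV actP VP) uVs vVs.
by rewrite -addrA -opprD subrr.
Qed.

(** Transfer: summed over a finite set, an integral cocycle becomes a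
    homomorphism to Z, and so vanishes on commutators. *)
Lemma zcocycle_commutator_sum (G : groupType) (S : finType)
    (act : G -> S -> S) (V : G -> S -> int) (u v : G) :
  is_action act -> is_zcocycle act V ->
  (\sum_s V (u * v * u^-1 * v^-1)%g s = 0)%R.
Proof.
move=> actP VP; pose sigma g := (\sum_s V g s)%R.
have sigmaM g h : sigma (g * h) = (sigma g + sigma h)%R.
  rewrite {3}/sigma [sigma g](reindex_inj (can_inj (actK actP h))) -big_split.
  by apply: eq_bigr => s _; apply: VP.
have sigma1 : sigma 1 = 0%R by apply: big1 => s _; apply: (zcocycle1 actP VP).
have sigmaV g : sigma g^-1 = (- sigma g)%R.
  by apply/eqP; rewrite -addr_eq0 -sigmaM mulVg sigma1.
rewrite -/(sigma _) !sigmaM !sigmaV.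
by rewrite -addrA -opprD subrr.
Qed.

(** * Integral linear equations *)

(** Euclidean division by the least positive element. *)
Lemma int_subgroup_cyclic (P : int -> Prop) :
  P 0%R -> (forall a b, P a -> P b -> P (a - b)%R) ->
  exists d : int, forall z, P z <-> exists k, z = (k * d)%R.
Proof.
move=> P0 PB.
have PN a : P a -> P (- a)%R by move=> Pa; rewrite -sub0r; apply: PB.
have PD a b : P a -> P b -> P (a + b)%R.
  by move=> Pa Pb; rewrite -[b]opprK; apply/PB/PN.
have PM k d : P d -> P (k * d)%R.
  move=> Pd; have Pn (n : nat) : P (Posz n * d)%R.
    elim: n => [|n IHn]; first by rewrite mul0r.
    by rewrite intS mulrDl mul1r; apply: PD.
  by case: k => n; rewrite ?NegzE ?mulNr; [|apply: PN].
have [exP|noP] := pselect (exists n : nat, `[< P (Posz n.+1) >]).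
  case: (ex_minnP exP) => n /asboolP Pn minn.
  exists (Posz n.+1) => z; split=> [Pz|[k ->]]; last exact: PM.
  exists (z %/ n.+1)%Z; rewrite {1}(divz_eq z (Posz n.+1)).
  have Pr : P (z %% n.+1)%Z.
    by rewrite /modz; apply/PB/PM.
  have [r Er] : exists r : nat, (z %% n.+1)%Z = r.
    exists `|(z %% n.+1)%Z|%N; rewrite gez0_abs// modz_ge0//.
  have lt_r : (r < n.+1)%N by rewrite -ltz_nat -Er ltz_pmod.
  case: r => [|r] in Er lt_r *; first by rewrite Er addr0.
  by rewrite Er in Pr; have := minn r (asboolT Pr); rewrite leqNgt -ltnS lt_r.
exists 0%R => z; split=> [Pz|[k ->]]; last by rewrite mulr0.
exists 0%R; rewrite mul0r; case: z Pz => [[|n]|n] Pz //.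
  by case: noP; exists n; apply/asboolP.
by case: noP; exists n; apply/asboolP; rewrite -[(Posz n.+1)]opprK -NegzE; apply: PN.
Qed.

Definition dotz (E : finType) (l f : E -> int) : int := (\sum_e l e * f e)%R.

(** The generator of [P] divides every [f e], hence their combination 1. *)
Lemma int_subgroup_full (E : finType) (f b : E -> int) (P : int -> Prop) :
  P 0%R -> (forall a b, P a -> P b -> P (a - b)%R) ->
  (forall e, P (f e)) -> dotz b f = 1%R -> forall t, P t.
Proof.
move=> P0 PB Pf bf t; have [d dP] := int_subgroup_cyclic P0 PB.
have /choice [k kE] : forall e, exists k, f e = (k * d)%R by move=> e; apply/dP.
apply/dP; exists (t * dotz b k)%R; rewrite -mulrA -[LHS]mulr1 -bf; congr (_ * _)%R.
by rewrite /dotz mulr_suml; apply: eq_bigr => e _; rewrite kE mulrA.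
Qed.

Lemma int_subgroup_full1 (P : int -> Prop) :
  P 0%R -> (forall a b, P a -> P b -> P (a - b)%R) -> P 1%R -> forall t, P t.
Proof.
move=> P0 PB P1; apply: (@int_subgroup_full unit (fun=> 1%R) (fun=> 1%R)) => //.
by rewrite /dotz big_const card_unit.
Qed.

(** With fewer equations than unknowns there is a nonzero rational solution;
    clearing denominators and dividing by the greatest common divisor makes it
    integral with coprime entries, which is expressed by a Bezout relation [b]. *)
Lemma primitive_solution (E Q : finType) (l : Q -> E -> int) :
  #|Q| < #|E| ->
  exists f b : E -> int, (forall q, dotz (l q) f = 0%R) /\ dotz b f = 1%R.
Proof.
move=> ltQE.
pose A : 'M[rat]_(#|E|, #|Q|) := (\matrix_(i, j) (l (enum_val j) (enum_val i))%:~R)%R.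
have kerN0 : kermx A != 0%R.
  rewrite -mxrank_eq0 mxrank_ker -lt0n subn_gt0.
  exact: leq_ltn_trans (rank_leq_col A) ltQE.
have [r /sub_kermxP rA r0] := rowV0Pn kerN0.
pose D := (\prod_i denq (r ord0 i))%R.
have D0 : D != 0%R by apply/prodf_neq0 => i _; apply: denq_neq0.
have /choice [z zE] : forall e, exists z : int,
    (z%:~R = D%:~R * r ord0 (enum_rank e))%R.
  move=> e; pose i := enum_rank e.
  exists (\prod_(j | j != i) denq (r ord0 j) * numq (r ord0 i))%R.
  rewrite /D [in RHS](bigD1 i)//= !intrM numqE mulrCA [RHS]mulrC.
  by congr (_ * _)%R; apply: mulrC.
have zl q : dotz (l q) z = 0%R.
  apply: (@intr_inj rat); rewrite rmorph_sum/=.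
  have := congr1 (fun M : 'M_(1, #|Q|) => M ord0 (enum_rank q)) rA.
  rewrite !mxE => /(congr1 (fun t => D%:~R * t)%R); rewrite mulr0 mulr_sumr.
  move=> rAq; apply: etrans rAq; rewrite (reindex_onto enum_val enum_rank) => [|e _]; last exact: enum_rankK.
  rewrite (eq_bigl xpredT) => [|i]; last by rewrite enum_valK eqxx.
 apply: eq_bigr => i _; rewrite !mxE enum_rankK intrM zE enum_valK.
  by rewrite mulrCA mulrA mulrC mulrCA mulrA.
have [e0 ze0] : exists e, z e != 0%R.
  have [i ri] : exists i, r ord0 i != 0%R by apply/rV0Pn.
  exists (enum_val i); rewrite -(@intr_eq0 rat) zE enum_valK mulf_neq0//.
  by rewrite intr_eq0.
have [||d dP] := @int_subgroup_cyclic (fun t => exists b, dotz b z = t).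
- by exists (fun=> 0%R); rewrite /dotz big1// => e _; rewrite mul0r.
- move=> _ _ [b <-] [c <-]; exists (fun e => b e - c e)%R.
  by rewrite /dotz -sumrB; apply: eq_bigr => e _; rewrite mulrBl.
have /choice [f fE] : forall e, exists k, z e = (k * d)%R.
  move=> e; apply/dP; exists (fun e' => (e' == e)%:R%R).
  rewrite /dotz (bigD1 e)//= eqxx mul1r big1 ?addr0// => e' /negPf ->.
  by rewrite mul0r.
have d0 : d != 0%R by apply: contraNneq ze0 => d0; rewrite fE d0 mulr0.
have dotzE b : dotz b z = (dotz b f * d)%R.
  by rewrite /dotz mulr_suml; apply: eq_bigr => e _; rewrite fE mulrA.
have [b bz] : exists b, dotz b z = d by apply/dP; exists 1%R; rewrite mul1r.
exists f, b; split=> [q|]; apply/(mulIf d0); rewrite -dotzE.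
  by rewrite zl mul0r.
by rewrite bz mul1r.
Qed.

(** The label of a fixed path is an integral linear form in the labels of the
    edges, so that cocycles supported on the edges [e i] and vanishing on the
    paths [p q] exist as soon as there are fewer paths than edges. *)
Lemma cocycle_solution (X : choiceType) (S : eqType)
    (act : free_group X -> S -> S) (E Q : finType) (e : E -> X * S)
    (p : Q -> free_group X * S) :
  is_action act -> injective e -> #|Q| < #|E| ->
  exists (V : free_group X -> S -> int) (b : E -> int),
    [/\ is_zcocycle act V,
        forall x s, (forall i, e i <> (x, s)) -> V (gen x) s = 0%R,
        forall q, V (p q).1 (p q).2 = 0%R
      & dotz b (fun i => V (gen (e i).1) (e i).2) = 1%R].
Proof.
move=> actP e_inj ltQE.
pose v (f : E -> int) x s := (\sum_(i | e i == (x, s)) f i)%R.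
have /choice [V VP] : forall f : E -> int, exists V : free_group X -> S -> int,
    is_zcocycle act V /\ forall x s, V (gen x) s = v f x s.
  move=> f; exact: (@free_cocycle X S act (Algebra.to_multiplicative int) (v f) actP).
have Vcoc f : is_zcocycle act (V f) by case: (VP f).
have VE f x s : V f (gen x) s = v f x s by case: (VP f).
have vE f x s : v f x s = dotz (fun i => (e i == (x, s))%:R%R) f.
  rewrite /v /dotz big_mkcond; apply: eq_bigr => i _.
  by case: eqP; rewrite ?mul1r ?mul0r.
have dotzD k l f : (dotz k f + dotz l f)%R = dotz (fun i => k i + l i)%R f.
  by rewrite /dotz -big_split; apply: eq_bigr => i _; rewrite mulrDl.
have dotzN k f : (- dotz k f)%R = dotz (fun i => - k i)%R f.
  by rewrite /dotz -sumrN; apply: eq_bigr => i _; rewrite mulNr.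
have lin g : forall s, exists l : E -> int, forall f, V f g s = dotz l f.
  elim/free_ind: g => [|x g IHg|x g IHg] s.
  - exists (fun=> 0%R) => f; rewrite (zcocycle1 actP)//.
    by rewrite /dotz big1// => i _; rewrite mul0r.
  - have [l lE] := IHg s; exists (fun i => (e i == (x, act g s))%:R + l i)%R => f.
    by rewrite Vcoc VE vE lE dotzD.
  - have [l lE] := IHg s.
    exists (fun i => - (e i == (x, act ((gen x)^-1)%g (act g s)))%:R + l i)%R => f.
    by rewrite Vcoc (zcocycleV actP)// VE vE lE -dotzD -dotzN.
have /choice [l lE] q := lin (p q).1 (p q).2.
have [f [b [fl bf]]] := primitive_solution l ltQE.
exists (V f), b; split=> //.
- move=> x s nxs; rewrite VE /v big_pred0// => i; exact/eqP.
- by move=> q; rewrite lE.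
rewrite -bf; apply: eq_bigr => i _; congr (_ * _)%R.
rewrite VE /v (bigD1 i)/= -?surjective_pairing// big1 ?addr0// => j.
by rewrite (inj_eq e_inj) => /andP[/eqP -> /negP].
Qed.

(** * Subgroups of finite index *)

(** The cosets in [finite_index] are right cosets [H x]; the map [q] sends
    [x] to the index of [H x^-1], so as to get left cosets and a left action. *)
Lemma finite_index_action (G : groupType) (H : groupClosed G) :
  finite_index H ->
  exists (N : nat) (q : G -> 'I_N) (act : G -> 'I_N -> 'I_N),
    [/\ is_action act, forall g x, q (g * x) = act g (q x),
        forall x y, q x = q y <-> x^-1 * y \in H & forall i, exists x, q x = i].
Proof.
pose coset (x : G) : set G := [set h * x | h in [set` H]].
move=> /finite_seqP [s sE].
have cosetE x y : coset x = coset y <-> x * y^-1 \in H.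
  split=> [xy|xyH].
    have: coset y x by rewrite -xy; exists 1; rewrite ?mul1g//; apply: gpred1.
    by case=> h hH <-; rewrite mulgK.
  apply/seteqP; split=> _ [h hH <-].
    by exists (h * (x / y)); [apply: gpredM | rewrite !mulgA mulgVK].
  exists (h / (x / y)); first exact: gpredF.
  by rewrite invgF -!mulgA mulVg mulg1.
have cosets x : coset x \in undup s.
  have: range coset (coset x) by exists x.
  by rewrite sE mem_undup.
pose N := size (undup s).
have ltN x : (index (coset x) (undup s) < N)%N by rewrite index_mem cosets.
pose q x : 'I_N := Ordinal (ltN x^-1).
have qE x y : q x = q y <-> x^-1 * y \in H.
  rewrite -{2}[y]invgK -cosetE; split=> [/(congr1 val)/= xy|xy].
    by rewrite -(nth_index set0 (cosets x^-1)) xy nth_index.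
  by apply: val_inj; rewrite /= xy.
have q_surj i : exists x, q x = i.
  have: nth set0 (undup s) i \in undup s by rewrite mem_nth.
  rewrite mem_undup => si; have: range coset (nth set0 (undup s) i) by rewrite sE.
  case=> x _ xE; exists x^-1; apply: val_inj.
  by rewrite /= invgK -/(coset x) [coset x]xE index_uniq// undup_uniq.
have /choice [t tE] := q_surj.
pose act g i := q (g * t i).
have actE g x : q (g * x) = act g (q x).
  by apply/qE; rewrite invgM -mulgA mulKg; apply/qE; rewrite tE.
exists N, q, act; split; [|exact: actE|exact: qE|exact: q_surj].
split=> [i|g h i]; first by rewrite /act mul1g tE.
by rewrite {1}/act -mulgA !actE tE.
Qed.

Lemma finite_index_map (G : groupType) (H : groupClosed G) (T : finType)
    (q : G -> T) :
  (forall x y, q x = q y -> x^-1 * y \in H) -> finite_index H.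
Proof.
move=> qH; pose coset (x : G) : set G := [set h * x | h in [set` H]].
have /choice [r rE] : forall t, exists x, (exists y, q y^-1 = t) -> q x^-1 = t.
  move=> t; have [[x xE]|no] := pselect (exists y, q y^-1 = t).
    by exists x.
  by exists 1.
apply: (@sub_finite_set _ _ ((coset \o r) @` setT)); last first.
  by apply: finite_image; apply: finite_finset.
move=> _ [x _ <-]; exists (q x^-1) => //=.
have /rE /qH : exists y, q y^-1 = q x^-1 by exists x.
rewrite invgK => rxH; apply/seteqP; split=> _ [h hH <-].
  exists (h * (r (q x^-1) / x)); first exact: gpredM.
  by rewrite -!mulgA mulVg mulg1.
exists (h / (r (q x^-1) / x)); first exact: gpredF.
by rewrite invgF -!mulgA mulVg mulg1.
Qed.

Lemma finite_index_preim (G K : groupType) (f : {multiplicative G -> K})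
    (M : groupClosed K) :
  finite_index M ->
  exists H : groupClosed G, finite_index H /\ forall x, x \in H <-> f x \in M.
Proof.
move=> /finite_index_action [N [q [act [_ _ qE _]]]].
have [|||H HE] := @subgroup_of_closed G (fun x => f x \in M).
- by rewrite hom_one gpred1.
- by move=> a b fa fb; rewrite gmulfM gpredM.
- by move=> a fa; rewrite hom_inv gpredV.
exists H; split=> //.
apply: (@finite_index_map _ _ _ (q \o f)) => x y /= /qE xy.
by apply/HE; rewrite gmulfM hom_inv.
Qed.

Lemma finite_index_trans (G : groupType) (H : groupClosed G)
    (M : groupClosed (subgroup H)) :
  finite_index H -> finite_index M ->
  exists L : groupClosed G, finite_index L /\
    forall x, x \in L <-> exists2 h, h \in M & val h = x.
Proof.
move=> /finite_index_action [N [q [_ [_ _ qE q_surj]]]].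
move=> /finite_index_action [N' [q' [_ [_ _ q'E _]]]].
have [|||L LE] := @subgroup_of_closed G (fun x => exists2 h, h \in M & val h = x).
- by exists 1; rewrite ?gpred1.
- by move=> _ _ [a aM <-] [b bM <-]; exists (a * b); rewrite ?gpredM.
- by move=> _ [a aM <-]; exists a^-1; rewrite ?gpredV.
exists L; split=> //.
have /choice [t tE] := q_surj.
have tH x : (t (q x))^-1 * x \in H by apply/qE.
pose r x := (q x, q' (Subgroup (tH x))).
apply: (@finite_index_map _ _ _ r) => x y [qxy /q'E rxy].
apply/LE; exists ((Subgroup (tH x))^-1 * Subgroup (tH y)) => //=.
by rewrite invgM invgK qxy -mulgA mulVKg.
Qed.

Lemma finite_index_power (G : groupType) (H : groupClosed G) (x : G) :
  finite_index H -> exists k : nat, x ^+ k.+1 \in H.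
Proof.
move=> /finite_index_action [N [q [_ [_ _ qE _]]]].
pose r (i : 'I_N.+1) := q (x ^+ i).
have /injectivePn [i [j ij rij]] : ~~ injectiveb r.
  apply/negP => /injectiveP /leq_card; rewrite !card_ord ltnn.
  by [].
wlog lt_ij : i j ij rij / (i < j)%N => [th|].
  have [||eq_ij] := ltngtP i j; [exact: th|apply: th|].
  - by rewrite eq_sym.
  - by rewrite rij.
  - by move: ij; rewrite (val_inj eq_ij) eqxx.
exists (j - i).-1; rewrite prednK ?subn_gt0//.
have -> : x ^+ (j - i) = (x ^+ i)^-1 * x ^+ j.
  by apply: (mulgI (x ^+ i)); rewrite mulVKg -expgnDr subnKC// ltnW.
exact/qE.
Qed.

Definition generated (G : groupType) (s : seq G) :=
  forall H : groupClosed G, (forall x, x \in s -> x \in H) -> forall x, x \in H.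

Lemma generated_image (G K : groupType) (f : {multiplicative G -> K}) (s : seq G) :
  (forall y, exists x, f x = y) -> generated s -> generated (map f s).
Proof.
move=> f_surj gens L sL y.
have [|||P PE] := @subgroup_of_closed G (fun x => f x \in L).
- by rewrite hom_one gpred1.
- by move=> a b fa fb; rewrite gmulfM gpredM.
- by move=> a fa; rewrite hom_inv gpredV.
have [x <-] := f_surj y; apply/PE; apply: gens => a sa; apply/PE/sL.
exact: map_f.
Qed.

Lemma free_generated (n : nat) : generated [seq gen i | i <- enum 'I_n].
Proof.
move=> H sH; elim/free_gen_ind => [|g h gH hH|g gH|i]; rewrite ?gpred1 ?gpredV//.
  exact: gpredM.
by apply: sH; rewrite map_f ?mem_enum.
Qed.

(** The Schreier generators [t (q (x t_i))^-1 * x * t_i] generate [H]: as a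
    function of [x], they form a cocycle on the cosets, so that they lie in a
    subgroup [K] for all [x] when they do so for the generators [x] of [G]. *)
Lemma finite_index_generated (G : groupType) (s : seq G) (H : groupClosed G) :
  generated s -> finite_index H -> exists s' : seq (subgroup H), generated s'.
Proof.
move=> gens /finite_index_action [N [q [act [actP qM qE q_surj]]]].
have /choice [t0 t0E] := q_surj.
pose t i := if i == q 1 then 1 else t0 i.
have tE i : q (t i) = i by rewrite /t; case: eqP.
have tH x i : (t (q (x * t i)))^-1 * (x * t i) \in H by apply/qE.
pose sg x i : subgroup H := Subgroup (tH x i).
have sgM x y i : sg (x * y) i = sg x (q (y * t i)) * sg y i.
  have E : q (x * t (q (y * t i))) = q (x * y * t i) by rewrite qM tE -qM mulgA.
  by apply: val_inj; rewrite /= E !mulgA mulgK.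
have sg1 i : sg 1 i = 1 by apply: val_inj; rewrite /= mul1g tE mulVg.
exists [seq sg x i | x <- s, i <- enum 'I_N] => K sK [h hH].
have [|||P PE] := @subgroup_of_closed G (fun x => forall i, sg x i \in K).
- by move=> i; rewrite sg1 gpred1.
- by move=> x y xP yP i; rewrite sgM gpredM.
- move=> x xP i; have := sgM x x^-1 i; rewrite mulgV sg1 => E.
  have -> : sg x^-1 i = (sg x (q (x^-1 * t i)))^-1 by apply/esym/mulg1_eq.
  by rewrite gpredV.
have /PE hP : h \in P.
  apply: gens => x xs; apply/PE => i; apply: sK; apply/allpairsP.
  by exists (x, i); rewrite mem_enum.
have t1 : t (q 1) = 1 by rewrite /t eqxx.
have qh : q h = q 1 by apply/qE; rewrite mulg1 gpredV.
have <- : sg h (q 1) = Subgroup hH by apply: val_inj; rewrite /= t1 mulg1 qh t1 invg1 mul1g.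
exact: hP.
Qed.

(** * Vanishing Alexander polynomial and largeness *)

Lemma free2_nonabelian : ~ abelian_group (free_group bool).
Proof. by move/(_ (gen true) (gen false))/(congr1 (@word _)). Qed.

(** Largeness of [G] can be tested in a group [F] that maps onto it: a
    homomorphism on [K] that is trivial on the kernel descends to the image. *)
Lemma large_from_cover (F G : groupType) (pi : {multiplicative F -> G})
    (K : F -> Prop) (rho : F -> free_group bool) (T : finType) (q : F -> T) :
  (forall x, exists g, pi g = x) ->
  K 1 -> (forall g h, K g -> K h -> K (g * h)) -> (forall g, K g -> K g^-1) ->
  (forall g, pi g = 1 -> K g /\ rho g = 1) ->
  (forall g h, K g -> K h -> rho (g * h) = rho g * rho h) ->
  (forall g h, q g = q h -> K (g^-1 * h)) ->
  (forall z, exists g, K g /\ rho g = z) ->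
  large G.
Proof.
move=> pi_surj K1 KM KV ker rhoM qK rho_surj.
have ker2 g h : pi g = pi h -> K g -> K h /\ rho h = rho g.
  move=> gh Kg; have [|Kgh rgh] := ker (g^-1 * h).
    by rewrite gmulfM hom_inv gh mulVg.
  have -> : h = g * (g^-1 * h) by rewrite mulVKg.
  by rewrite rhoM// rgh mulg1; split=> //; apply: KM.
have [|||H HE] := @subgroup_of_closed G (fun x => exists g, pi g = x /\ K g).
- by exists 1; rewrite hom_one.
- move=> _ _ [g [<- Kg]] [h [<- Kh]]; exists (g * h).
  by rewrite gmulfM; split=> //; apply: KM.
- by move=> _ [g [<- Kg]]; exists g^-1; rewrite hom_inv; split=> //; apply: KV.
have /choice [l lE] := pi_surj.
exists H; split.
  apply: (@finite_index_map _ _ _ (fun x => q (l x))) => x y /qK Kxy.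
  by apply/HE; exists ((l x)^-1 * l y); rewrite gmulfM hom_inv !lE.
exists bool; split; first exact: free2_nonabelian.
have lK x : x \in H -> K (l x).
  by move=> /HE [g [gx Kg]]; apply: (proj1 (ker2 g (l x) _ Kg)); rewrite lE.
pose f0 (x : subgroup H) := rho (l (val x)).
have f0M : {morph f0 : x y / x * y >-> x * y}.
  move=> x y; rewrite /f0 -rhoM; try exact/lK/valP.
  have [||_ -> //] := @ker2 (l (val x) * l (val y)) (l (val (x * y))).
    by rewrite gmulfM !lE.
  by apply: KM; apply/lK/valP.
pose f : {multiplicative subgroup H -> free_group bool} :=
  HB.pack f0 (isMultiplicative.Build _ _ f0 f0M).
exists f; apply/seteqP; split=> // z _.
have [g [Kg <-]] := rho_surj z.
have pgH : pi g \in H by apply/HE; exists g.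
exists (Subgroup pgH) => //=.
by rewrite /f0 /=; have [|_ ->] := @ker2 g (l (pi g)) _ Kg.
Qed.

Section Cover.
Variables (n : nat) (R : 'I_n.-1 -> free_group 'I_n) (k0 : 'I_n.-1).
Variables (u v : free_group 'I_n).
Hypothesis Rk0 : R k0 = u * v * u^-1 * v^-1.
Variables (N : nat) (act : free_group 'I_n -> 'I_N -> 'I_N) (i0 : 'I_N).
Hypothesis actP : is_action act.
Hypothesis actR : forall k i, act (R k) i = i.
Hypotheses (act_u : act u i0 = i0) (act_v : act v i0 = i0).
Variable g : 'I_N -> free_group 'I_n.
Hypotheses (gP : forall i, act (g i) i0 = i) (g0 : g i0 = 1).

(** In both systems of equations below, a pair [(Some k, i)] stands for the
    lift at [i] of the [k]-th relator, and [(None, i)] for an extra condition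
    attached to [i].  There are then as many pairs as edges in the cover, and it
    is enough to make one pair redundant. *)
Lemma card_cells : (#|{: option 'I_n.-1 * 'I_N}| = n * N)%N.
Proof.
by rewrite card_prod card_option !card_ord prednK//; case: n k0 => [[]|].
Qed.

Lemma card_cells1 (x : option 'I_n.-1 * 'I_N) :
  #|{: {y : option 'I_n.-1 * 'I_N | y != x}}| = (n * N).-1.
Proof. by rewrite card_sig -card_cells -(cardC1 x); apply: eq_card. Qed.

Lemma cells_gt0 : (0 < n * N)%N.
Proof. by rewrite -card_cells; apply/card_gt0P; exists (Some k0, i0). Qed.

(** The homomorphism from the stabiliser of [i0] onto Z, as a cocycle [c] that
    vanishes on the transversal [g].  The relator [k0] at [i0] gives no
    condition once [u] and [v] are killed, and its condition at [i1] follows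
    from those at the other points by transfer.  So the pair [(Some k0, i0)] is
    used to kill [u], the pair [(None, i0)] to kill [v], and [(Some k0, i1)] is
    dropped. *)
Lemma commutator_class (i1 : 'I_N) : i1 != i0 ->
  exists (c : free_group 'I_n -> 'I_N -> int) (b : 'I_n * 'I_N -> int),
    [/\ is_zcocycle act c, forall k i, c (R k) i = 0%R,
        c u i0 = 0%R /\ c v i0 = 0%R, forall i, c (g i) i0 = 0%R
      & dotz b (fun e => c (gen e.1) e.2) = 1%R].
Proof.
move=> i10.
pose Q := {y : option 'I_n.-1 * 'I_N | y != (Some k0, i1)}.
pose p0 (y : option 'I_n.-1 * 'I_N) := match y with
  | (Some k, i) => if (k == k0) && (i == i0) then (u, i0) else (R k, i)
  | (None, i) => if i == i0 then (v, i0) else (g i, i0)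
  end.
have [||c [b [cP _ c0 bc]]] := @cocycle_solution _ _ act
    ('I_n * 'I_N)%type Q id (fun q => p0 (val q)) actP.
- by [].
- by rewrite card_cells1 card_prod !card_ord prednK// cells_gt0.
have {}c0 y : y != (Some k0, i1) -> c (p0 y).1 (p0 y).2 = 0%R.
  by move=> yN; apply: (c0 (exist _ y yN)).
have cu : c u i0 = 0%R.
  have := c0 (Some k0, i0); rewrite /p0 !eqxx; apply.
  by apply/eqP => -[] /esym; apply/eqP.
have cv : c v i0 = 0%R by have := c0 (None, i0); rewrite /p0 eqxx; apply.
have cg i : c (g i) i0 = 0%R.
  have [->|ii0] := eqVneq i i0; first by rewrite g0 (zcocycle1 actP cP).
  by have := c0 (None, i); rewrite /p0 (negPf ii0); apply.
have ck0 : c (R k0) i0 = 0%R by rewrite Rk0 (zcocycle_commutator actP cP).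
have cR k i : (k, i) != (k0, i1) -> c (R k) i = 0%R.
  move=> ki; have := c0 (Some k, i); rewrite /p0.
  case: ifP => [/andP[/eqP -> /eqP -> _]//|_]; apply.
  by apply: contraNneq ki => -[-> ->].
exists c, b; split=> // k i.
have [[-> ->]|] := eqVneq (k, i) (k0, i1); last exact: cR.
have := zcocycle_commutator_sum u v actP cP; rewrite -Rk0 (bigD1 i1)//=.
rewrite big1 ?addr0// => j ji1; apply: cR.
by apply: contraNneq ji1 => -[->].
Qed.

Variables (c : free_group 'I_n -> 'I_N -> int).
Hypotheses (cP : is_zcocycle act c) (cR : forall k i, c (R k) i = 0%R).

(** The action on the infinite cyclic cover defined by [c]; the second
    component is the level. *)
Definition lift_act (h : free_group 'I_n) (s : 'I_N * int) : 'I_N * int :=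
  (act h s.1, s.2 + c h s.1)%R.

Lemma lift_actP : is_action lift_act.
Proof.
split=> [[i a]|h h' [i a]]; rewrite /lift_act /=.
  by rewrite (act1 actP) (zcocycle1 actP cP) addr0.
by rewrite (actM actP) cP [(c h _ + _)%R]addrC addrA.
Qed.

(** The path that reads [h] stays within [l] levels of its origin; stated in
    terms of labels, this says that they only depend on those of the edges in
    this range. *)
Definition is_local (h : free_group 'I_n) (l : nat) :=
  forall (A : groupType) (V W : free_group 'I_n -> 'I_N * int -> A) i (a : int),
    is_cocycle lift_act V -> is_cocycle lift_act W ->
    (forall x j b, (`|b - a| <= l%:R)%R -> V (gen x) (j, b) = W (gen x) (j, b)) ->
    V h (i, a) = W h (i, a).

Lemma locality (h : free_group 'I_n) : exists l : nat, is_local h l.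
Proof.
have bound (f : 'I_N -> int) i : (`|f i| <= (\sum_i `|f i|%N)%N%:R)%R.
  rewrite (bigD1 i)//= natrD -[`|f i|%R]abszE natz.
  by rewrite lerDl ler0n.
elim/free_ind: h => [|x h [l IHl]|x h [l IHl]].
- by exists 0%N => A V W i a VP WP _; rewrite (cocycle1 lift_actP VP) (cocycle1 lift_actP WP).
- exists (l + \sum_i `|c h i|)%N => A V W i a VP WP VW.
  rewrite VP WP; congr (_ * _).
    apply: VW; rewrite /= addrAC subrr add0r natrD.
    by rewrite (le_trans (bound (c h) i))// lerDr ler0n.
  apply: IHl => // y j b ba; apply: VW; rewrite (le_trans ba)//.
  by rewrite ler_nat leq_addr.
- pose f := c ((gen x)^-1 * h); exists (l + \sum_i `|f i|)%N => A V W i a VP WP VW.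
  rewrite VP WP; congr (_ * _).
    rewrite (cocycleV lift_actP VP) (cocycleV lift_actP WP); congr (_^-1).
    rewrite -(actM lift_actP); apply: VW; rewrite /= addrAC subrr add0r natrD.
    by rewrite (le_trans (bound f i))// lerDr ler0n.
  apply: IHl => // y j b ba; apply: VW; rewrite (le_trans ba)//.
  by rewrite ler_nat leq_addr.
Qed.

Lemma is_local_le h l l' : (l <= l')%N -> is_local h l -> is_local h l'.
Proof.
move=> ll' hl A V W i a VP WP VW; apply: hl => // x j b ba; apply: VW.
by rewrite (le_trans ba)// ler_nat.
Qed.

Variable w : free_group 'I_n.
Hypotheses (cu : c u i0 = 0%R) (cv : c v i0 = 0%R).

(** The paths on which the cocycles of the cyclic cover have to vanish: the
    relators, the transversal and [w], which will be a loop at [i0] going up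
    one level. *)
Definition cell_path (y : option 'I_n.-1 * 'I_N) : free_group 'I_n * 'I_N :=
  match y with
  | (Some k, i) => (R k, i)
  | (None, i) => (if i == i0 then w else g i, i0)
  end.

Lemma uniform_locality : exists l, forall y, is_local (cell_path y).1 l.
Proof.
have /choice [l lP] : forall y, exists l, is_local (cell_path y).1 l.
  by move=> y; apply: locality.
exists (\sum_y l y)%N => y; apply: is_local_le (lP y).
by rewrite (bigD1 y)//= leq_addr.
Qed.

(** Only the levels from [- l] to [M + l] give conditions on a cocycle
    supported on the levels from [0] to [M].  Over [i0], the lift of the
    commutator relator is a commutator of loops at every level, so that there
    are at most [(n N - 1) (M + 2 l)] conditions on [n N M] unknowns. *)
Lemma level_solution (l : nat) :
  (forall y, is_local (cell_path y).1 l) ->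
  exists (M : nat) (V : free_group 'I_n -> 'I_N * int -> int)
      (b : 'I_n * 'I_N * 'I_M -> int),
    [/\ is_zcocycle lift_act V,
        forall x i (a : int), ~~ (0 <= a < M%:R)%R -> V (gen x) (i, a) = 0%R,
        forall y a, V (cell_path y).1 ((cell_path y).2, a) = 0%R
      & dotz b (fun e => V (gen e.1.1) (e.1.2, Posz e.2)) = 1%R].
Proof.
move=> locl; pose M := (2 * l * (n * N)).+1; exists M.
pose Q := ({y : option 'I_n.-1 * 'I_N | y != (Some k0, i0)} * 'I_(M + 2 * l))%type.
pose e (x : 'I_n * 'I_N * 'I_M) := (x.1.1, (x.1.2, Posz x.2)).
pose p (q : Q) := ((cell_path (val q.1)).1,
  ((cell_path (val q.1)).2, (Posz q.2 - l%:R)%R)).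
have e_inj : injective e.
  by move=> [[x i] a] [[x' i'] a'] [-> ->] /val_inj ->.
have ltQE : (#|{: Q}| < #|{: 'I_n * 'I_N * 'I_M}|)%N.
  rewrite !card_prod card_cells1 !card_ord.
  have := cells_gt0; rewrite /M; case: (n * N)%N => // t _; nia.
have [V [b [VP Vsupp V0 bV]]] := cocycle_solution p lift_actP e_inj ltQE.
have {}Vsupp x i (a : int) : ~~ (0 <= a < M%:R)%R -> V (gen x) (i, a) = 0%R.
  move=> aM; apply: Vsupp => -[[x' i'] a'] [_ _ aE].
  by move: aM; rewrite -aE natz ltz_nat ltn_ord.
have Vu a : V (R k0) (i0, a) = 0%R.
  rewrite Rk0 (zcocycle_commutator lift_actP VP)// /lift_act /=.
    by rewrite act_u cu addr0.
  by rewrite act_v cv addr0.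
exists V, b; split=> // y a.
have [-> |yN] := eqVneq y (Some k0, i0); first exact: Vu.
have [aM|aM] := boolP (- l%:R <= a < M%:R + l%:R)%R.
  have lta : (`|(a + l%:R)%R|%N < M + 2 * l)%N by lia.
  have := V0 (exist _ y yN, Ordinal lta).
  by rewrite /p /= gez0_abs ?addrK//; lia.
pose T := Algebra.to_multiplicative int.
apply: (locl y T V (fun _ _ => 1)); [exact: VP|by move=> ? ? ?; rewrite mulg1|].
by move=> x j b' b'a; apply: Vsupp; lia.
Qed.

Hypotheses (act_w : act w i0 = i0) (cw : c w i0 = 1%R).
Hypothesis cg : forall i, c (g i) i0 = 0%R.
Variables (G : groupType) (pi : {multiplicative free_group 'I_n -> G}).
Hypothesis pi_surj : forall x, exists h, pi h = x.
Hypothesis pi_ker : forall h, pi h = 1 <-> h \in normal_closure (range R).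

(** The edges in the fundamental period that carry the labels [y ^ V0] have
    coprime exponents [V0], so that loops through these edges give [y]; the
    translation by one period gives [s]. *)
Lemma cover_large : large G.
Proof.
have [l locl] := uniform_locality.
have [M [V0 [b [V0P V0supp V0path bV0]]]] := level_solution locl.
(* Two consecutive blocks are separated by more than twice the range [l]. *)
pose m' := (M + 2 * l)%N; pose m : int := Posz m'.+1.
have m0 : m != 0%R by [].
have div_uniq (j r : int) : (0 <= r < m)%R ->
    ((j * m + r)%R %/ m)%Z = j /\ ((j * m + r)%R %% m)%Z = r.
  move=> rm; rewrite divzMDl// divz_small ?addr0; last by rewrite -[`|_|%N]/m'.+1.
  by rewrite modzMDl modz_small.
pose y := gen true; pose s := gen false.
pose cj (t : int) z := zexp s (- t)%R * z * zexp s t.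
have cjM t z z' : cj t (z * z') = cj t z * cj t z'.
  by rewrite /cj !mulgA zexpN mulgK.
have cj1 t : cj t 1 = 1 by rewrite /cj mulg1 -zexpD addNr.
have cjD t t' z : cj (t + t')%R z = cj t' (cj t z).
  by rewrite /cj zexpD opprD [(- t + _)%R]addrC zexpD !mulgA.
(* [vol] labels the [j]-th block by powers of [s^-j y s^j]. *)
pose vol x (e : 'I_N * int) := cj (e.2 %/ m)%Z
  (zexp y (V0 (gen x) (e.1, (e.2 %% m)%Z))).
have [V [VP VE]] := free_cocycle vol lift_actP.
(* The same labelling with all the blocks but the [j]-th erased: it is the
   image of an integral cocycle, so that it vanishes where [V0] does. *)
pose W (j : int) h (e : 'I_N * int) := cj j (zexp y (V0 h (e.1, (e.2 - j * m)%R))).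
have WP j : is_cocycle lift_act (W j).
  move=> h h' [i a]; rewrite /W -cjM -zexpD; congr (cj _ (zexp _ _)).
  by rewrite V0P /lift_act /= addrAC.
have Vpath p a : V (cell_path p).1 ((cell_path p).2, a) = 1.
  (* The [j]-th block is the only one that the path can meet: if [a'] is below
     [j * m], then it is one of the last [2 * l] levels of the period before,
     which carry no labels. *)
  pose j := ((a + l%:R)%R %/ m)%Z.
  rewrite (locl p _ V (W j)) => //; first by rewrite /W V0path cj1.
  move=> x i a' a'a; rewrite VE /vol /W /=.
  have aE : (a + l%:R)%R = (j * m + ((a + l%:R)%R %% m)%Z)%R by rewrite -divz_eq.
  have rm : (0 <= ((a + l%:R)%R %% m)%Z < m)%R by rewrite modz_ge0// ltz_pmod.
  have [ja|aj] := lerP (j * m)%R a'.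
    have [|dE rE] := div_uniq j (a' - j * m)%R; first by lia.
    by rewrite addrCA subrr addr0 in dE rE; rewrite dE rE.
  have rm' : (M%:R <= a' - (j - 1) * m < m)%R by rewrite mulrBl mul1r; lia.
  have [|dE rE] := div_uniq (j - 1)%R (a' - (j - 1) * m)%R; first by lia.
  rewrite addrCA subrr addr0 in dE rE; rewrite dE rE.
  rewrite (V0supp _ _ (a' - j * m)%R) ?(V0supp _ _ (_ - (j - 1) * m)%R) ?cj1//.
    by case/andP: rm' => rm' _; rewrite negb_and -leNgt rm' orbT.
  by rewrite negb_and -ltNge subr_lt0 aj.
have Vshift t h i a : V h (i, a + t * m)%R = cj t (V h (i, a)).
  pose V1 h (e : 'I_N * int) := V h (e.1, (e.2 + t * m)%R).
  pose V2 h (e : 'I_N * int) := cj t (V h e).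
  apply: (@cocycle_eq _ _ lift_act _ V1 V2 lift_actP _ _ _ h (i, a)).
  - by move=> h1 h2 [i' a']; rewrite /V1 VP /lift_act /= addrAC.
  - by move=> h1 h2 e; rewrite /V2 VP cjM.
  move=> x [i' a']; rewrite /V1 /V2 !VE /vol /= -cjD addrC divzMDl// modzMDl.
  by rewrite addrC.
have VR k i a : V (R k) (i, a) = 1 by exact: (Vpath (Some k, i)).
have Vg i a : V (g i) (i0, a) = 1.
  have [->|ii0] := eqVneq i i0; first by rewrite g0 (cocycle1 lift_actP VP).
  by have := Vpath (None, i) a; rewrite /= (negPf ii0).
have Vw a : V w (i0, a) = 1 by have := Vpath (None, i0) a; rewrite /= eqxx.
(* [rho] is [V h (i0, 0)] corrected by the translation by [c h i0], so as to be
   multiplicative on [K]. *)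
pose K h := act h i0 = i0 /\ exists t, c h i0 = (t * m)%R.
pose rho h := zexp s (c h i0 %/ m)%Z * V h (i0, 0%R).
have rhoE h t : c h i0 = (t * m)%R -> rho h = zexp s t * V h (i0, 0%R).
  by move=> ct; rewrite /rho ct mulzK.
have c1 i : c 1 i = 0%R by exact: (zcocycle1 actP cP).
have K1 : K 1 by split; [exact: act1|exists 0%R; rewrite mul0r].
have KM h h' : K h -> K h' -> K (h * h').
  move=> [hi [t ct]] [h'i [t' ct']]; split; first by rewrite (actM actP) h'i.
  by exists (t + t')%R; rewrite cP h'i ct ct' mulrDl.
have KV h : K h -> K h^-1.
  move=> [hi [t ct]]; have hVi := act_fixV actP hi; split=> //.
  by exists (- t)%R; rewrite (zcocycleV actP cP) hVi ct mulNr.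
have rhoM h h' : K h -> K h' -> rho (h * h') = rho h * rho h'.
  move=> [hi [t ct]] [h'i [t' ct']].
  rewrite (rhoE _ (t + t')%R); last by rewrite cP h'i ct ct' mulrDl.
  rewrite (rhoE _ _ ct) (rhoE _ _ ct') VP /lift_act /= h'i ct' Vshift /cj zexpN.
  by rewrite zexpD !mulgA mulgK.
have rho1 : rho 1 = 1.
  by rewrite (rhoE _ 0%R) ?mul0r// (cocycle1 lift_actP VP) mulg1.
have rhoV h : K h -> rho h^-1 = (rho h)^-1.
  by move=> Kh; apply: (mulgI (rho h)); rewrite mulgV -rhoM ?mulgV//; apply: KV.
have ker h : pi h = 1 -> K h /\ rho h = 1.
  move=> /pi_ker hN.
  have [ha hV] : (forall e, lift_act h e = e) /\ (forall e, V h e = 1).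
    move: h hN; apply: normal_closure_min => [|h h' [ha hV] [h'a h'V]|h [ha hV]
      |h h' [ha hV]|_ [k _ <-]].
    - by split=> e; [exact: (act1 lift_actP)|exact: (cocycle1 lift_actP VP)].
    - by split=> e; rewrite ?(actM lift_actP) ?VP ?h'a ?ha ?h'V ?hV ?mulg1.
    - split=> e; first exact: (act_fixV lift_actP).
      by rewrite (cocycleV lift_actP VP) hV invg1.
    - split=> e; rewrite /conjg.
        by rewrite !(actM lift_actP) ha (actK lift_actP).
      rewrite !VP (cocycleV lift_actP VP) (actM lift_actP) ha (actK lift_actP).
      by rewrite hV mul1g mulVg.
    - split=> -[i a]; last exact: VR.
      by rewrite /lift_act /= actR cR addr0.
  have [hi hc] : act h i0 = i0 /\ c h i0 = 0%R.
    by have := ha (i0, 0%R); rewrite /lift_act /= add0r => -[-> ->].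
  split; first by split=> //; exists 0%R; rewrite mul0r.
  by rewrite (rhoE _ 0%R) ?mul0r// hV mulg1.
pose q h : 'I_N * 'I_m'.+1 := (act h i0, inord `|(c h i0 %% m)%Z|%N).
have qK h h' : q h = q h' -> K (h^-1 * h').
  move=> [hi /(congr1 val)]; rewrite /= !inordK; last 2 first.
  - by rewrite -ltz_nat gez0_abs ?modz_ge0 ?ltz_pmod.
  - by rewrite -ltz_nat gez0_abs ?modz_ge0 ?ltz_pmod.
  move=> /(congr1 Posz); rewrite !gez0_abs ?modz_ge0// => hc; split.
    by rewrite (actM actP) -hi (actK actP).
  exists ((c h' i0 %/ m)%Z - (c h i0 %/ m)%Z)%R.
  rewrite cP (zcocycleV actP cP) -hi (actK actP) mulrBl.
  rewrite {1}(divz_eq (c h i0) m) {1}(divz_eq (c h' i0) m) hc.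
  by rewrite opprD addrACA [(- (c h' i0 %% m)%Z + _)%R]addrC subrr addr0 addrC.
(* Unlabelled loops at [i0] going up by any number of levels: the powers of
   [w]. *)
have shift : forall t, exists h,
    [/\ act h i0 = i0, c h i0 = t & forall a, V h (i0, a) = 1].
  apply: int_subgroup_full1.
  - by exists 1; split=> [||a]; [exact: act1|exact: c1|exact: (cocycle1 lift_actP VP)].
  - move=> t t' [h [hi ht hV]] [h' [h'i h't h'V]]; exists (h * h'^-1).
    have h'Vi := act_fixV actP h'i.
    have h'c : c h'^-1 i0 = (- t')%R by rewrite (zcocycleV actP cP) h'Vi h't.
    split=> [||a]; first by rewrite (actM actP) h'Vi.
      by rewrite cP h'Vi ht h'c.
    rewrite VP (cocycleV lift_actP VP) /lift_act /= h'Vi hV h'c.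
    by rewrite h'V invg1 mulg1.
  - by exists w.
have imM z z' : (exists h, K h /\ rho h = z) -> (exists h, K h /\ rho h = z') ->
    exists h, K h /\ rho h = z * z'.
  move=> [h [Kh <-]] [h' [Kh' <-]]; exists (h * h').
  by rewrite rhoM//; split=> //; apply: KM.
have imV z : (exists h, K h /\ rho h = z) -> exists h, K h /\ rho h = z^-1.
  by move=> [h [Kh <-]]; exists h^-1; rewrite rhoV//; split=> //; apply: KV.
have im1 : exists h, K h /\ rho h = 1 by exists 1.
apply: (@large_from_cover _ _ pi K rho _ q) => //.
elim/free_gen_ind => // -[].
  suff /(_ 1%R) : forall t, exists h, K h /\ rho h = zexp y t by rewrite /= expg1.
  apply: (@int_subgroup_full _ _ b) bV0 => //.
    by move=> t t' im im'; rewrite zexpD zexpN; apply/imM/imV.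
  move=> [[x i] a] /=.
  (* A loop whose only nontrivial label is that of the edge [x] at [(i, a)]:
     up to level [a], along the transversal to [i], through the edge, and back
     to [i0] and to level [0]. *)
  have [h2 [h2i h2c h2V]] := shift (Posz a).
  have [h1 [h1i h1c h1V]] := shift (- (Posz a + c (gen x) i))%R.
  pose j := act (gen x) i.
  have gVj : act (g j)^-1 j = i0 by rewrite -{2}(gP j) (actK actP).
  have gVc : c (g j)^-1 j = 0%R by rewrite (zcocycleV actP cP) gVj cg oppr0.
  exists (h1 * ((g j)^-1 * (gen x * (g i * h2)))).
  have E1 : act (g i * h2) i0 = i by rewrite (actM actP) h2i gP.
  have E2 : act (gen x * (g i * h2)) i0 = j by rewrite (actM actP) E1.
  have E3 : act ((g j)^-1 * (gen x * (g i * h2))) i0 = i0.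
    by rewrite (actM actP) E2.
  have F1 : c (g i * h2) i0 = Posz a by rewrite cP h2i cg h2c add0r.
  have F2 : c (gen x * (g i * h2)) i0 = (Posz a + c (gen x) i)%R.
    by rewrite cP E1 F1 addrC.
  have F3 : c ((g j)^-1 * (gen x * (g i * h2))) i0 = (Posz a + c (gen x) i)%R.
    by rewrite cP E2 gVc F2 add0r.
  have F4 : c (h1 * ((g j)^-1 * (gen x * (g i * h2)))) i0 = (0 * m)%R.
    by rewrite cP E3 h1c F3 addNr mul0r.
  have L h : lift_act h (i0, 0%R) = (act h i0, c h i0).
    by rewrite /lift_act /= add0r.
  split; first by split; [rewrite (actM actP) E3|exists 0%R].
  rewrite (rhoE _ _ F4) /= mul1g VP L E3 h1V mul1g.
  rewrite VP L E2 F2 (cocycleV lift_actP VP) /lift_act /= gVj Vg invg1 mul1g.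
  rewrite VP L E1 F1 VP h2V L h2i Vg !mulg1 VE /vol /=.
  have [|aE rE] := div_uniq 0%R (Posz a).
    by rewrite /m /m' ltz_nat; have := ltn_ord a; lia.
  by rewrite mul0r add0r in aE rE; rewrite aE rE /cj oppr0 /= mul1g mulg1.
have [h [hi hc hV]] := shift m; exists h.
have hc1 : c h i0 = (1 * m)%R by rewrite mul1r.
by rewrite (rhoE _ _ hc1) hV mulg1; split=> //; split=> //; exists 1%R.
Qed.

End Cover.

(** The set on which the free group acts is [G / H]; [z] provides the second
    point [i1] that [commutator_class] needs.  The loop [w] exists because [c] is
    primitive: the loops through the various edges, closed up along the
    transversal, climb by coprime numbers of levels. *)
Lemma large_of_proper (n : nat) (R : 'I_n.-1 -> free_group 'I_n)
    (G : groupType) (pi : {multiplicative free_group 'I_n -> G})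
    (k0 : 'I_n.-1) (u v : free_group 'I_n) (H : groupClosed G) (z : G) :
  (forall x, exists h, pi h = x) ->
  (forall h, pi h = 1 <-> h \in normal_closure (range R)) ->
  R k0 = u * v * u^-1 * v^-1 ->
  finite_index H -> pi u \in H -> pi v \in H -> z \notin H -> large G.
Proof.
move=> pi_surj pi_ker Rk0 /finite_index_action[N [q [actG [actGP qM qE q_surj]]]].
move=> uH vH zH; pose act h i := actG (pi h) i.
have actP : is_action act.
  split=> [i|h h' i]; first by rewrite /act hom_one (act1 actGP).
  by rewrite /act gmulfM (actM actGP).
pose i0 := q 1; pose i1 := q z.
have i10 : i1 != i0.
  by apply: contra zH => /eqP/esym/qE; rewrite invg1 mul1g.
have act0 h : act h i0 = q (pi h) by rewrite /act /i0 -qM mulg1.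
have stab h : pi h \in H -> act h i0 = i0.
  by move=> hH; rewrite act0; apply/esym/qE; rewrite invg1 mul1g.
have piR k : pi (R k) = 1 by apply/pi_ker/sub_normal_closure; exists k.
have actR k i : act (R k) i = i by rewrite /act piR (act1 actGP).
have /choice [g gE] : forall i, exists h, act h i0 = i /\ (i = i0 -> h = 1).
  move=> i; have [->|/eqP ii0] := eqVneq i i0.
    by exists 1; split=> //; apply: act1.
  have [x xi] := q_surj i; have [h hx] := pi_surj x; exists h.
  rewrite act0 hx xi.
  by split=> // /ii0.
have gP i : act (g i) i0 = i by case: (gE i).
have g0 : g i0 = 1 by case: (gE i0) => _; apply.
have [c [b [cP cR [cu cv] cg bc]]] :=
  commutator_class Rk0 actP (stab _ uH) (stab _ vH) g0 i10.
have [w [act_w cw]] : exists w, act w i0 = i0 /\ c w i0 = 1%R.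
  apply: (int_subgroup_full (P := fun t => exists w, act w i0 = i0 /\ c w i0 = t) _ _ _ bc).
  - by exists 1; rewrite (act1 actP) (zcocycle1 actP cP).
  - move=> _ _ [h [hi <-]] [h' [h'i <-]]; exists (h * h'^-1).
    have h'Vi := act_fixV actP h'i.
    by rewrite (actM actP) cP (zcocycleV actP cP) h'Vi.
  - move=> [x i] /=; exists ((g (act (gen x) i))^-1 * (gen x * g i)).
    have gVi : act (g (act (gen x) i))^-1 (act (gen x) i) = i0.
      by rewrite -{2}(gP (act (gen x) i)) (actK actP).
    rewrite !cP !(actM actP) (zcocycleV actP cP) !gP gVi.
    by rewrite !cg oppr0 addr0 add0r.
exact: (cover_large Rk0 actP actR (stab _ uH) (stab _ vH) gP g0 cP cR cu cv
  act_w cw cg pi_surj pi_ker).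
Qed.

(** * Abelianisations *)

Lemma commg_derived (G : groupType) (x y : G) : [~ x, y] \in derived_subgroup G.
Proof. by apply/asboolP => H; apply. Qed.

Lemma derived_min (G : groupType) (H : groupClosed G) :
  (forall x y, [~ x, y] \in H) -> forall x, x \in derived_subgroup G -> x \in H.
Proof. by move=> RH x /asboolP; apply. Qed.

Lemma hom_derived (G A : groupType) (f : {multiplicative G -> A}) :
  abelian_group A -> forall x, x \in derived_subgroup G -> f x = 1.
Proof.
move=> abA; have [|||K KE] := @subgroup_of_closed G (fun x => f x = 1).
- exact: hom_one.
- by move=> x y fx fy; rewrite gmulfM fx fy mulg1.
- by move=> x fx; rewrite hom_inv fx invg1.
move=> x xD; apply/KE; apply: derived_min xD => y z; apply/KE.
rewrite /commg /conjg !gmulfM !hom_inv [_ * (_ * f z)](abA) /=.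
by rewrite -mulgA mulgV mulg1 mulVg.
Qed.

Lemma abelianisation_epi (G : groupType) :
  exists p : {multiplicative G -> abelianisation G},
    (forall y, exists x, p x = y) /\
    (forall x, p x = 1 <-> x \in derived_subgroup G).
Proof. exact: (quo_epi (derived_subgroup G)). Qed.

Lemma abelianisation_abelian (G : groupType) : abelian_group (abelianisation G).
Proof.
have [p [p_surj pE]] := abelianisation_epi G => x y.
have [x' <-] := p_surj x; have [y' <-] := p_surj y.
apply/commgP/eqP; rewrite /commg /conjg -!hom_inv -!gmulfM.
exact/pE/commg_derived.
Qed.

Lemma ZxZ_abelian : abelian_group ZxZ.
Proof. by move=> [a b] [c d]; congr (_, _); apply: addrC. Qed.

Lemma isomorphic_sym (G K : groupType) : isomorphic G K -> isomorphic K G.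
Proof.
move=> [f [f' fK f'K]].
have f'M : {morph f' : x y / x * y >-> x * y}.
  by move=> x y; apply: (can_inj fK); rewrite gmulfM !f'K.
pose h : {multiplicative K -> G} :=
  HB.pack f' (isMultiplicative.Build _ _ f' f'M).
by exists h; exists f.
Qed.

Lemma isomorphic_of_hom (G K : groupType) (f : {multiplicative G -> K}) :
  (forall x, f x = 1 -> x = 1) -> (forall y, exists x, f x = y) ->
  isomorphic G K.
Proof.
move=> /hom_inj f_inj /choice [f' f'K]; exists f; exists f' => // x.
by apply: f_inj; rewrite f'K.
Qed.

Lemma isomorphic_abelianisation (G K : groupType) :
  abelian_group G -> isomorphic (abelianisation G) K -> isomorphic G K.
Proof.
move=> abG [f f_bij]; have [p [p_surj pE]] := abelianisation_epi G.
have [f' fK f'K] := f_bij.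
have hM : {morph f \o p : x y / x * y >-> x * y}.
  by move=> x y; rewrite /= !gmulfM.
pose h : {multiplicative G -> K} :=
  HB.pack (f \o p) (isMultiplicative.Build _ _ (f \o p) hM).
apply: (@isomorphic_of_hom _ _ h) => [x hx|y]; last first.
  by have [x xE] := p_surj (f' y); exists x; rewrite /= xE f'K.
have [T TE] := trivial_subgroup G.
apply/TE; apply: (@derived_min _ T) => [a b|].
  by apply/TE/eqP/commgP/abG.
by apply/pE; apply: (can_inj fK); rewrite hom_one.
Qed.

Lemma abelianisation_ZxZ (G : groupType) (g1 g2 : G) :
  (forall x, exists a b, x / (zexp g1 a * zexp g2 b) \in derived_subgroup G) ->
  (forall a b, zexp g1 a * zexp g2 b \in derived_subgroup G ->
     a = 0%R /\ b = 0%R) ->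
  isomorphic (abelianisation G) ZxZ.
Proof.
move=> span free; have [p [p_surj pE]] := abelianisation_epi G.
have abA := @abelianisation_abelian G.
pose f0 (e : ZxZ) := zexp (p g1) e.1 * zexp (p g2) e.2.
have f0M : {morph f0 : x y / x * y >-> x * y}.
  move=> [a b] [a' b']; rewrite /f0 /= !zexpD -!mulgA; congr (_ * _).
  by rewrite !mulgA; congr (_ * _); apply: abA.
pose f : {multiplicative ZxZ -> abelianisation G} :=
  HB.pack f0 (isMultiplicative.Build _ _ f0 f0M).
have fE a b : f (a, b) = p (zexp g1 a * zexp g2 b).
  by rewrite gmulfM !hom_zexp.
apply: isomorphic_sym; apply: (@isomorphic_of_hom _ _ f).
  by move=> [a b]; rewrite fE => /pE /free [-> ->].
move=> y; have [x <-] := p_surj y; have [a [b /pE ab]] := span x.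
exists (a, b); rewrite fE; apply: esym; apply: divg1_eq.
by rewrite -hom_inv -gmulfM.
Qed.

(** * Finitely generated abelian groups are subgroup separable *)

Section AbelianSeparable.
Variables (A : groupType).
Hypothesis abA : abelian_group A.

Lemma adjoin_closed (M : groupClosed A) (y : A) :
  exists M' : groupClosed A,
    forall z, z \in M' <-> exists p, z / zexp y p \in M.
Proof.
apply: subgroup_of_closed.
- by exists 0%R; rewrite /= mulgV gpred1.
- move=> a b [p ap] [r br]; exists (p + r)%R.
  have -> : a * b / zexp y (p + r)%R = (a / zexp y p) * (b / zexp y r).
    rewrite zexpD invgM -!mulgA; congr (_ * _).
    by rewrite (abA (zexp y p)^-1) -!mulgA.
  exact: gpredM.
- move=> a [p ap]; exists (- p)%R.
  by rewrite zexpN (abA a^-1) -invgM gpredV.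
Qed.

(** Some power of [y] can be added to [M] without capturing [x]. *)
Lemma adjoin_power (M : groupClosed A) (x y : A) : x \notin M ->
  exists (M' : groupClosed A) (k : nat),
    [/\ forall z, z \in M -> z \in M', x \notin M' & y ^+ k.+1 \in M'].
Proof.
move=> xM.
have [[k yk]|tf] := pselect (exists k : nat, y ^+ k.+1 \in M).
  by exists M, k.
have tfz e : zexp y e \in M -> e = 0%R.
  case: e => [[|k]|k] //= yM; case: tf; exists k => //.
  by rewrite -gpredV.
(* The powers of [y] being distinct modulo [M], at most one power [y ^ e] is
   congruent to [x], and [e] is not [0]; it is not a multiple of [|e| + 1]. *)
have [k kP] : exists k : nat, forall p : int,
    x / zexp y (Posz k.+1 * p)%R \notin M.
  have [[e xe]|no] := pselect (exists e, x / zexp y e \in M); last first.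
    by exists 0%N => p; apply/negP => xp; apply: no; exists (Posz 1 * p)%R.
  exists `|e|%N => p; apply/negP => xp.
  have /tfz ee : zexp y (e - Posz `|e|.+1 * p)%R \in M.
    rewrite zexpD zexpN.
    have -> : zexp y e / zexp y (Posz `|e|.+1 * p)%R =
        (x / zexp y (Posz `|e|.+1 * p)%R) / (x / zexp y e).
      by rewrite invgF [RHS]abA mulgA mulgVK.
    exact: gpredF.
  have e0 : e = 0%R.
    move/eqP: ee; rewrite subr_eq0 => /eqP ee.
    have [p0|p0] := eqVneq p 0%R; first by rewrite ee p0 mulr0.
    have : (`|e|.+1 <= `|e|.+1 * `|p|)%N by rewrite leq_pmulr// absz_gt0.
    by rewrite -[X in (_ <= X)%N]/(`|Posz `|e|.+1|%N * `|p|)%N -abszM -ee ltnn.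
  by move: xM; rewrite -[x]divg1 -[1]/(zexp y 0%R) -e0 xe.
have [M' M'E] := adjoin_closed M (y ^+ k.+1).
have powE p : zexp (y ^+ k.+1) p = zexp y (Posz k.+1 * p)%R by rewrite zexpM.
exists M', k; split.
- by move=> z zM; apply/M'E; exists 0%R; rewrite /= divg1.
- by apply/negP => /M'E [p]; rewrite powE; apply/negP.
- by apply/M'E; exists 1%R; rewrite /= expg1 mulgV gpred1.
Qed.

Lemma adjoin_powers (s : seq A) (M : groupClosed A) (x : A) : x \notin M ->
  exists M' : groupClosed A, [/\ forall z, z \in M -> z \in M', x \notin M'
    & forall y, y \in s -> exists k : nat, y ^+ k.+1 \in M'].
Proof.
elim: s M => [|y s IHs] M xM; first by exists M.
have [M1 [k [MM1 xM1 yM1]]] := adjoin_power y xM.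
have [M2 [M12 xM2 sM2]] := IHs M1 xM1.
exists M2; split=> // [z /MM1 /M12 //|z].
by rewrite in_cons => /orP[/eqP ->|/sM2 //]; exists k; apply: M12.
Qed.

(** An abelian group that is generated by [s] modulo [M] is finite modulo [M]
    when the elements of [s] are torsion modulo [M]. *)
Lemma finite_transversal (s : seq A) (M : groupClosed A) :
  (forall y, y \in s -> exists k : nat, y ^+ k.+1 \in M) ->
  (forall H : groupClosed A, (forall z, z \in M -> z \in H) ->
     (forall y, y \in s -> y \in H) -> forall z, z \in H) ->
  exists t : seq A, forall z, exists2 a, a \in t & z / a \in M.
Proof.
elim: s M => [|y s IHs] M tors gens.
  exists [:: 1] => z; exists 1; rewrite ?mem_head// divg1.
  exact: gens.
have [M' M'E] := adjoin_closed M y.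
have MM' z : z \in M -> z \in M'.
  by move=> zM; apply/M'E; exists 0%R; rewrite /= divg1.
have yM' : y \in M' by apply/M'E; exists 1%R; rewrite /= expg1 mulgV gpred1.
have [z sz|H M'H sH|t tP] := IHs M'.
- have [|k zk] := tors z; first by rewrite in_cons sz orbT.
  by exists k; apply: MM'.
- apply: gens => [z /MM' /M'H //|z].
  by rewrite in_cons => /orP[/eqP ->|/sH //]; apply: M'H.
have [|k yk] := tors y; first exact: mem_head.
exists [seq y ^+ e * a | e <- iota 0 k.+1, a <- t] => z.
have [a ta /M'E [p zap]] := tP z.
pose r := (p %% k.+1)%Z.
have [e eE] : exists e : nat, r = e.
  by exists `|r|%N; rewrite gez0_abs// modz_ge0.
have lt_e : (e < k.+1)%N by rewrite -ltz_nat -eE ltz_pmod.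
exists (y ^+ e * a).
  by apply/allpairsP; exists (e, a); rewrite mem_iota.
have -> : z / (y ^+ e * a) = (z / a / zexp y p) * zexp (y ^+ k.+1) (p %/ k.+1)%Z.
  rewrite -[y ^+ k.+1]/(zexp y k.+1) -zexpM invgM -mulgA -zexpN -zexpD mulgA.
  congr (_ * _); rewrite -[y ^+ e]/(zexp y e) -zexpN; congr (zexp y _).
  have := divz_eq p k.+1; rewrite -/r eE mulrC => {1}->.
  by rewrite opprD addrAC addNr add0r.
apply: gpredM => //; exact: gpred_zexp.
Qed.

(** Adding to [M] suitable powers of all the generators keeps [x] out and makes
    the quotient finite. *)
Lemma abelian_separable (s : seq A) (M : groupClosed A) (x : A) :
  generated s -> x \notin M ->
  exists M' : groupClosed A,
    [/\ finite_index M', forall z, z \in M -> z \in M' & x \notin M'].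
Proof.
move=> gens /(adjoin_powers s) [M' [MM' xM' tors]].
have [|t tP] := finite_transversal tors; first by move=> H _; apply: gens.
exists M'; split=> //.
have ltr z : (find (fun a => z / a \in M') t < size t)%N.
  by rewrite -has_find; apply/hasP; have [a ta za] := tP z; exists a.
apply: (@finite_index_map _ _ _ (fun z => Ordinal (ltr z))) => y z /(congr1 val)/= yz.
have yP : y / nth 1 t (find (fun a => y / a \in M') t) \in M'.
  by apply: (nth_find 1 (a := fun a => y / a \in M')); rewrite has_find.
have zP : z / nth 1 t (find (fun a => y / a \in M') t) \in M'.
  by rewrite yz; apply: (nth_find 1 (a := fun a => z / a \in M')); rewrite has_find.
by have := gpredF zP yP; rewrite invgF mulgA mulgVK abA.
Qed.

End AbelianSeparable.

(** The image of [H] is a lattice in Z x Z; it has a basis in echelon form,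
    [(a, 0)] and [(b, d)], and both [a] and [d] are nonzero because [H]
    contains powers of preimages of [(1, 0)] and [(0, 1)]. *)
Lemma finite_index_ZxZ (G : groupType) (f : {multiplicative G -> ZxZ})
    (H : groupClosed G) :
  (forall y, exists x, f x = y) -> finite_index H ->
  (forall h : subgroup H, f (val h) = 1 -> h \in derived_subgroup (subgroup H)) ->
  isomorphic (abelianisation (subgroup H)) ZxZ.
Proof.
move=> f_surj fiH kerf.
pose f1 (x : G) : int := (f x).1; pose f2 (x : G) : int := (f x).2.
have fD x y : f1 (x * y) = (f1 x + f1 y)%R /\ f2 (x * y) = (f2 x + f2 y)%R.
  by rewrite /f1 /f2 gmulfM.
have fN x : f1 x^-1 = (- f1 x)%R /\ f2 x^-1 = (- f2 x)%R.
  by rewrite /f1 /f2 hom_inv.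
have fz x k : f1 (zexp x k) = (k * f1 x)%R /\ f2 (zexp x k) = (k * f2 x)%R.
  elim/int_rect: k => [|k [IH1 IH2]|k [IH1 IH2]].
  - by rewrite !mul0r /f1 /f2 /= hom_one.
  - rewrite -addn1 PoszD zexpD !mulrDl !mul1r.
    by have [-> ->] := fD (zexp x k) (zexp x 1); rewrite IH1 IH2 /= expg1.
  - rewrite -addn1 PoszD opprD zexpD !mulrDl !mulN1r.
    have [-> ->] := fD (zexp x (- Posz k)%R) (zexp x (- 1)%R); rewrite IH1 IH2.
    by rewrite zexpN /= expg1; have [-> ->] := fN x.
have [|| d dP] := @int_subgroup_cyclic (fun t => exists2 h, h \in H & f2 h = t).
- by exists 1; [exact: gpred1|rewrite /f2 hom_one].
- move=> _ _ [h hH <-] [h' h'H <-]; exists (h / h'); first exact: gpredF.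
  by have [_ ->] := fD h h'^-1; have [_ ->] := fN h'.
have [|| a aP] := @int_subgroup_cyclic
    (fun t => exists2 h, h \in H & f2 h = 0%R /\ f1 h = t).
- by exists 1; [exact: gpred1|rewrite /f1 /f2 hom_one].
- move=> _ _ [h hH [h2 <-]] [h' h'H [h'2 <-]]; exists (h / h'); first exact: gpredF.
  have [-> ->] := fD h h'^-1; have [-> ->] := fN h'.
  by rewrite h2 h'2 oppr0 addr0.
have a0 : a != 0%R.
  have [x fx] := f_surj (1%R, 0%R); have [k xk] := finite_index_power x fiH.
  have [|l] := proj1 (aP (Posz k.+1)).
    exists (x ^+ k.+1) => //; have [E1 E2] := fz x (Posz k.+1).
    by rewrite E1 E2 /f1 /f2 fx /= mulr0 mulr1.
  by apply: contra_eqN => /eqP ->; rewrite mulr0.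
have d0 : d != 0%R.
  have [x fx] := f_surj (0%R, 1%R); have [k xk] := finite_index_power x fiH.
  have [|l] := proj1 (dP (Posz k.+1)).
    exists (x ^+ k.+1) => //; have [E1 E2] := fz x (Posz k.+1).
    by rewrite E2 /f2 fx /= mulr1.
  by apply: contra_eqN => /eqP ->; rewrite mulr0.
have [h1 h1H [h1d h1a]] : exists2 h, h \in H & f2 h = 0%R /\ f1 h = a.
  by apply/aP; exists 1%R; rewrite mul1r.
have [h2 h2H h2d] : exists2 h, h \in H & f2 h = d.
  by apply/dP; exists 1%R; rewrite mul1r.
pose g1 : subgroup H := Subgroup h1H; pose g2 : subgroup H := Subgroup h2H.
have valM (x y : subgroup H) : val (x * y) = val x * val y by [].
have valV (x : subgroup H) : val x^-1 = (val x)^-1 by [].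
have valz (x : subgroup H) k : val (zexp x k) = zexp (val x) k.
  elim/int_rect: k => [|k IH|k IH] //.
    by rewrite -addn1 PoszD !zexpD valM IH.
  by rewrite -addn1 PoszD opprD !zexpD valM IH.
have gE p r : f1 (val (zexp g1 p * zexp g2 r)) = (p * a + r * f1 h2)%R /\
    f2 (val (zexp g1 p * zexp g2 r)) = (r * d)%R.
  rewrite valM !valz /=; have [-> ->] := fD (zexp h1 p) (zexp h2 r).
  have [-> ->] := fz h1 p; have [-> ->] := fz h2 r.
  by rewrite h1a h1d h2d mulr0 add0r.
apply: (@abelianisation_ZxZ _ g1 g2) => [x|p r pr].
  have [r rE] : exists r, f2 (val x) = (r * d)%R.
    by apply/dP; exists (val x) => //; apply: valP.
  have [p pE] : exists p, (f1 (val x) - r * f1 h2)%R = (p * a)%R.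
    apply/aP; exists (val x / zexp h2 r).
      by apply: gpredF; [exact: valP|exact: gpred_zexp].
    have [-> ->] := fD (val x) (zexp h2 r)^-1; have [-> ->] := fN (zexp h2 r).
    by have [-> ->] := fz h2 r; rewrite h2d rE subrr.
  exists p, r; apply: kerf; rewrite valM valV.
  have [E1 E2] := gE p r.
  have [F1 F2] := fD (val x) (val (zexp g1 p * zexp g2 r))^-1.
  have [N1 N2] := fN (val (zexp g1 p * zexp g2 r)).
  rewrite [f _]surjective_pairing -/(f1 _) -/(f2 _) F1 F2 N1 N2 E1 E2 -pE rE.
  by rewrite subrK !subrr.
have fvalM : {morph f \o val : x y / (x : subgroup H) * y >-> x * y}.
  by move=> x y; rewrite /= gmulfM.
pose fval : {multiplicative subgroup H -> ZxZ} :=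
  HB.pack (f \o val) (isMultiplicative.Build _ _ (f \o val) fvalM).
have fpr := hom_derived fval ZxZ_abelian pr.
have [E1 E2] := gE p r; move: E1 E2.
rewrite /f1 /f2 -[f _]/(fval _) fpr /= => /esym E1 /esym E2.
have r0 : r = 0%R by apply/(mulIf d0); rewrite E2 mul0r.
split=> //; apply/(mulIf a0); rewrite mul0r.
by move: E1; rewrite r0 mul0r addr0.
Qed.

(** * Large groups have nonabelian finite quotients *)

Lemma free_nonabelian_gen (X : choiceType) :
  ~ abelian_group (free_group X) -> exists x y : X, x <> y.
Proof.
move=> nab; apply: contrapT => no; apply: nab => g h.
have E (x y : X) : x = y by apply: contrapT => xy; apply: no; exists x, y.
have cgen (x : X) : forall h, commute (gen x) h.
  apply: free_gen_ind => [|a b|a|y].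
  - exact: commute1.
  - exact: commuteM.
  - exact: commuteV.
  - by rewrite (E y x).
apply: commute_sym; elim/free_gen_ind: g => [|a b ha hb|a ha|x].
- exact: commute1.
- exact: commuteM.
- exact: commuteV.
- exact/commute_sym/cgen.
Qed.

(** Two distinct generators of the free quotient are sent to two transpositions
    of three letters that do not commute. *)
Lemma large_commutator (G : groupType) : large G ->
  exists (H : groupClosed G) (x y : G), finite_index H /\ [~ x, y] \notin H.
Proof.
move=> [H [fiH [X [nab [f fsurj]]]]].
have [a [b ab]] := free_nonabelian_gen nab.
pose s : 'S_3 := tperm (inord 0) (inord 1); pose t : 'S_3 := tperm (inord 1) (inord 2).
have st : ~ commute s t.
  move/permP/(_ (inord 0)); rewrite !permE /=.
  have i01 : (inord 1 : 'I_3) != inord 0 by rewrite -val_eqE /= !inordK.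
  have i20 : (inord 2 : 'I_3) != inord 0 by rewrite -val_eqE /= !inordK.
  have i21 : (inord 2 : 'I_3) != inord 1 by rewrite -val_eqE /= !inordK.
  by rewrite tpermL tpermL (tpermD i01 i20) tpermL => /eqP; rewrite (negPf i21).
have [phi phiE] := free_hom (fun x => if x == a then s else t).
have psiM : {morph phi \o f : x y / x * y >-> x * y}.
  by move=> x y; rewrite /= !gmulfM.
pose psi : {multiplicative subgroup H -> 'S_3} :=
  HB.pack (phi \o f) (isMultiplicative.Build _ _ (phi \o f) psiM).
have [T TE] := trivial_subgroup 'S_3.
have fiT : finite_index T.
  by apply: (@finite_index_map _ _ {perm 'I_3} (fun x => x)) => x y ->; apply/TE; rewrite mulVg.
have [M [fiM ME]] := finite_index_preim psi fiT.
have [L [fiL LE]] := finite_index_trans fiH fiM.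
have [ha _ fa] : range f (gen a) by rewrite fsurj.
have [hb _ fb] : range f (gen b) by rewrite fsurj.
exists L, (val ha), (val hb); split=> //; apply/negP => /LE [h hM hE].
have {hE} hE : h = [~ ha, hb] by apply: val_inj.
apply: st; apply/commgP/eqP; move: hM; rewrite hE => /ME/TE.
rewrite /commg /conjg !gmulfM !hom_inv /= fa fb !phiE eqxx.
by case: eqP => // /esym.
Qed.

(** * Groups that are not large *)

Lemma hom_descend (n m : nat) (R : 'I_m -> free_group 'I_n) (G A : groupType)
    (pi : {multiplicative free_group 'I_n -> G})
    (phi : {multiplicative free_group 'I_n -> A}) :
  (forall x, exists h, pi h = x) ->
  (forall h, pi h = 1 <-> h \in normal_closure (range R)) ->
  (forall k, phi (R k) = 1) ->
  exists f : {multiplicative G -> A}, forall h, f (pi h) = phi h.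
Proof.
move=> pi_surj pi_ker phiR.
have ker h : pi h = 1 -> phi h = 1.
  move=> /pi_ker; move: h; apply: normal_closure_min => [|x y fx fy|x fx|x y fx|_ [k _ <-]].
  - exact: hom_one.
  - by rewrite gmulfM fx fy mulg1.
  - by rewrite hom_inv fx invg1.
  - by rewrite /conjg !gmulfM fx mul1g hom_inv mulVg.
  - exact: phiR.
have /choice [l lE] := pi_surj.
have eq_pi h h' : pi h = pi h' -> phi h = phi h'.
  move=> hh'; apply: divg1_eq; rewrite -hom_inv -gmulfM; apply: ker.
  by rewrite gmulfM hom_inv hh' mulgV.
have fM : {morph phi \o l : x y / x * y >-> x * y}.
  by move=> x y; rewrite /= -gmulfM; apply: eq_pi; rewrite gmulfM !lE.
pose f : {multiplicative G -> A} :=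
  HB.pack (phi \o l) (isMultiplicative.Build _ _ (phi \o l) fM).
by exists f => h; apply: eq_pi; rewrite lE.
Qed.

Section NotLarge.
Variables (G : groupType) (n : nat) (R : 'I_n.-1 -> free_group 'I_n).
Variables (pi : {multiplicative free_group 'I_n -> G}).
Hypothesis pi_surj : forall x, exists h, pi h = x.
Hypothesis pi_ker : forall h, pi h = 1 <-> h \in normal_closure (range R).
Variables (k0 : 'I_n.-1) (u v : free_group 'I_n).
Hypothesis Rk0 : R k0 = u * v * u^-1 * v^-1.
Hypothesis not_large : ~ large G.

Lemma not_large_full (H : groupClosed G) :
  finite_index H -> pi u \in H -> pi v \in H -> forall z, z \in H.
Proof.
move=> fiH uH vH z; apply: contrapT => /negP zH; apply: not_large.
exact: (large_of_proper pi_surj pi_ker Rk0 fiH uH vH zH).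
Qed.

Lemma piR k : pi (R k) = 1.
Proof. by apply/pi_ker/sub_normal_closure; exists k. Qed.

Lemma commute_uv : commute (pi u) (pi v).
Proof.
have := piR k0; rewrite Rk0 !gmulfM !hom_inv => /divg1_eq uvu.
by rewrite /commute -[in RHS]uvu mulgVK.
Qed.

(** [K] is the subgroup of the elements that act on [G / H] like some
    [u ^ a v ^ b]; it has finite index, so it is the whole of [G], and [G] acts
    on [G / H] through an abelian group. *)
Lemma not_large_commutators (H : groupClosed G) :
  finite_index H -> forall x y, [~ x, y] \in H.
Proof.
move=> /finite_index_action [N [q [act [actP qM qE q_surj]]]] x y.
pose P x := exists a b, forall i, act x i = act (zexp (pi u) a * zexp (pi v) b) i.
have [|||K KE] := @subgroup_of_closed G P.
- by exists 0%R, 0%R => i; rewrite /= mulg1.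
- move=> g h [a [b gE]] [a' [b' hE]]; exists (a + a')%R, (b + b')%R => i.
  rewrite (actM actP) gE hE -(actM actP) !zexpD !mulgA; congr (act (_ * _) _).
  rewrite -!mulgA; congr (_ * _).
  exact/commute_zexp/commute_sym/commute_uv.
- move=> g [a [b gE]]; exists (- a)%R, (- b)%R => i.
  apply: (can_inj (actK actP g)); rewrite (actVK actP) gE -(actM actP).
  rewrite (commute_zexp (- a)%R (- b)%R commute_uv).
  by rewrite !zexpN -invgM mulgV (act1 actP).
have fiK : finite_index K.
  apply: (@finite_index_map _ _ _ (fun x => [ffun i => act x i])) => g h /ffunP gh.
  apply/KE; exists 0%R, 0%R => i; rewrite /= mulg1 (act1 actP) (actM actP).
  by have := gh i; rewrite !ffunE => <-; rewrite (actK actP).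
have inK z : z \in K.
  apply: (not_large_full fiK); apply/KE.
    by exists 1%R, 0%R => i; rewrite /= mulg1 expg1.
  by exists 0%R, 1%R => i; rewrite /= mul1g expg1.
have act_comm g h i : act (g * h) i = act (h * g) i.
  have /KE [a [b gE]] := inK g; have /KE [a' [b' hE]] := inK h.
  rewrite !(actM actP) [in LHS]hE gE [in RHS]gE hE -!(actM actP).
  congr (act _ i); apply: commuteM.
    apply/commute_sym/commuteM; apply: commute_zexp => //.
    exact: commute_uv.
  apply/commute_sym/commuteM; apply: commute_zexp => //.
  exact/commute_sym/commute_uv.
have : q 1 = q [~ x, y]; last by move/qE; rewrite invg1 mul1g.
rewrite -[[~ x, y]]mulg1 qM /commg /conjg.
have E : act (y^-1 * (x * y)) (q 1) = act x (q 1).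
  by rewrite (actM actP) act_comm -(actM actP) mulKg.
by rewrite (actM actP) E (actK actP).
Qed.

(** Otherwise separability provides a proper subgroup of finite index that
    contains [pi u] and [pi v]. *)
Lemma not_large_span x : exists a b,
  x / (zexp (pi u) a * zexp (pi v) b) \in derived_subgroup G.
Proof.
have [p [p_surj pE]] := abelianisation_epi G.
have abA := @abelianisation_abelian G.
have gensA := generated_image p_surj (generated_image pi_surj (@free_generated n)).
have [|||M ME] := @subgroup_of_closed (abelianisation G)
    (fun z => exists a b, z = p (zexp (pi u) a * zexp (pi v) b)).
- by exists 0%R, 0%R; rewrite /= mulg1 hom_one.
- move=> _ _ [a [b ->]] [a' [b' ->]]; exists (a + a')%R, (b + b')%R.
  rewrite !zexpD !gmulfM -!mulgA; congr (_ * _); rewrite !mulgA; congr (_ * _).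
  exact: abA.
- move=> _ [a [b ->]]; exists (- a)%R, (- b)%R.
  by rewrite -hom_inv invgM !zexpN !gmulfM; apply: abA.
have [/ME [a [b pxab]]|pxM] := boolP (p x \in M).
  exists a, b; apply/pE; rewrite gmulfM hom_inv pxab mulgV //.
have [M' [fiM' MM' pxM']] := abelian_separable abA gensA pxM.
have [H [fiH HE]] := finite_index_preim p fiM'.
have : x \in H.
  apply: (not_large_full fiH); apply/HE/MM'/ME.
    by exists 1%R, 0%R; rewrite /= mulg1 expg1.
  by exists 0%R, 1%R; rewrite /= mul1g expg1.
by move/HE; rewrite (negPf pxM').
Qed.

(** A relation would leave room for a homomorphism onto Z that kills [u] and
    [v], and the preimage of 2Z would be a proper subgroup. *)
Lemma not_large_free a b :
  zexp (pi u) a * zexp (pi v) b \in derived_subgroup G -> a = 0%R /\ b = 0%R.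
Proof.
move=> abD; apply: contrapT => ab0.
have triv : is_action (fun (_ : free_group 'I_n) (s : unit) => s) by [].
(* Once [w] is killed, the relation between [u] and [v] forces a homomorphism to
   Z to kill them both; the condition on [w] takes the place of the relator [k0],
   which leaves [n - 1] conditions on [n] unknowns. *)
pose w := if a == 0%R then u else v.
pose p k := (if k == k0 then w else R k, tt).
have [||V [c [VP _ V0 cV]]] := @cocycle_solution _ _ _ 'I_n 'I_n.-1
    (fun i => (i, tt)) p triv.
- by move=> i j [].
- by rewrite !card_ord; case: n k0 => [[]|] // m' _; rewrite leqnn.
pose Z := Algebra.to_multiplicative int.
have phiM : {morph (fun h => V h tt : Z) : x y / x * y >-> x * y}.
  by move=> x y; apply: VP.
pose phi : {multiplicative free_group 'I_n -> Z} :=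
  HB.pack (fun h => V h tt : Z) (isMultiplicative.Build _ _ (fun h => V h tt : Z) phiM).
have ZabC : abelian_group Z by move=> x y; apply: addrC.
have phiR k : phi (R k) = 1.
  have [->|kk0] := eqVneq k k0.
    rewrite Rk0 !gmulfM !hom_inv [phi u * _]ZabC mulgK mulgV //.
  by have := V0 k; rewrite /p (negPf kk0).
have [f fE] := hom_descend pi_surj pi_ker phiR.
have fw : phi w = 0%R by have := V0 k0; rewrite /p eqxx.
have zexpZ (x : Z) k : zexp x k = (k * x)%R.
  elim/int_rect: k => [|k IH|k IH]; first by rewrite mul0r.
    by rewrite -addn1 PoszD zexpD mulrDl mul1r IH /= expg1.
  by rewrite -addn1 PoszD opprD zexpD mulrDl mulN1r IH zexpN /= expg1.
have f_ab : (a * phi u + b * phi v)%R = 0%R.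
  have := hom_derived f ZabC abD.
  by rewrite gmulfM !hom_zexp !fE !zexpZ.
have [phiu phiv] : phi u = 0%R /\ phi v = 0%R.
  move: fw f_ab; rewrite /w; have [a0|a0] := eqVneq a 0%R => ->.
    rewrite a0 mul0r add0r => /eqP; rewrite mulf_eq0 => /orP[/eqP b0|/eqP //].
    by case: ab0.
  by rewrite mulr0 addr0 => /eqP; rewrite mulf_eq0 (negPf a0) => /eqP.
have [|||T TE] := @subgroup_of_closed Z (fun z => exists k : int, z = (2 * k)%R).
- by exists 0%R.
- by move=> _ _ [k ->] [k' ->]; exists (k + k')%R; rewrite mulrDr.
- by move=> _ [k ->]; exists (- k)%R; rewrite mulrN.
have fiT : finite_index T.
  apply: (@finite_index_map _ _ _ (fun z : Z => odd `|z|%N)) => x y xy.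
  have E : x^-1 * y = (y - x)%R by rewrite addrC.
  apply/TE; exists ((y - x) %/ 2)%Z; rewrite E.
  move: x y xy {E}; rewrite /Z /Algebra.to_multiplicative => x y xy; lia.
have [H [fiH HE]] := finite_index_preim f fiT.
have inH : forall z, z \in H.
  by apply: (not_large_full fiH); apply/HE/TE; exists 0%R; rewrite fE ?phiu ?phiv.
have /choice [d dE] : forall i, exists k : int, V (gen i) tt = (2 * k)%R.
  by move=> i; have /HE/TE [k] := inH (pi (gen i)); rewrite fE => E; exists k.
have : exists k : int, 1%R = (2 * k)%R.
  exists (dotz c d); apply: etrans (esym cV) _; rewrite /dotz mulr_sumr.
  by apply: eq_bigr => i _; rewrite dE mulrCA.
by move=> [k]; lia.
Qed.

Lemma not_large_abelianisation : isomorphic (abelianisation G) ZxZ.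
Proof. exact: abelianisation_ZxZ not_large_span not_large_free. Qed.

Lemma not_large_RA : residually_abelianised G.
Proof.
have [p [p_surj pE]] := abelianisation_epi G.
have abA := @abelianisation_abelian G.
have gensA := generated_image p_surj (generated_image pi_surj (@free_generated n)).
apply/seteqP; split=> x /=; last first.
  by move=> xD H /not_large_commutators HC; apply: derived_min xD.
move=> xI; apply: contrapT => /negP xD.
have [T TE] := trivial_subgroup (abelianisation G).
have pxT : p x \notin T by apply: contra xD => /TE /pE.
have [M [fiM _ pxM]] := abelian_separable abA gensA pxT.
have [H [fiH HE]] := finite_index_preim p fiM.
by have /HE := xI H fiH; rewrite (negPf pxM).
Qed.

(** An element [x] of [H] in [G'] but not in [H'] would be left out by a finite
    index subgroup of [H], which contains [G'].  Hence [H'] is the kernel of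
    [H -> G / G']. *)
Lemma not_large_finite_index (H : groupClosed G) :
  finite_index H -> isomorphic (abelianisation (subgroup H)) ZxZ.
Proof.
move=> fiH; have [f [f' fK f'K]] := not_large_abelianisation.
have [p [p_surj pE]] := abelianisation_epi G.
have hM : {morph f \o p : x y / x * y >-> x * y}.
  by move=> x y; rewrite /= !gmulfM.
pose h : {multiplicative G -> ZxZ} :=
  HB.pack (f \o p) (isMultiplicative.Build _ _ (f \o p) hM).
apply: (@finite_index_ZxZ _ h) => // [y|x hx].
  by have [x xE] := p_surj (f' y); exists x; rewrite /= xE f'K.
have xD : val x \in derived_subgroup G.
  by apply/pE; apply: (can_inj fK); rewrite hom_one.
apply: contrapT => /negP xH'.
have [s gens] := finite_index_generated
  (generated_image pi_surj (@free_generated n)) fiH.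
have [r [r_surj rE]] := abelianisation_epi (subgroup H).
have abA := @abelianisation_abelian (subgroup H).
have [T TE] := trivial_subgroup (abelianisation (subgroup H)).
have rxT : r x \notin T by apply: contra xH' => /TE /rE.
have [M [fiM _ rxM]] := abelian_separable abA (generated_image r_surj gens) rxT.
have [K [fiK KE]] := finite_index_preim r fiM.
have [L [fiL LE]] := finite_index_trans fiH fiK.
have /LE [y yK /val_inj yx] : val x \in L.
  exact: derived_min (not_large_commutators fiL) _ xD.
by move: rxM; rewrite -yx; move/KE: yK => ->.
Qed.

End NotLarge.

Theorem theorem3p6 (G : groupType) (n : nat)
    (R : 'I_n.-1 -> free_group 'I_n)
    (presG : presents R G)
    (commR : exists i, is_commutator (R i)) :
  exactly_one
    (isomorphic G ZxZ)
    (nara G /\ isomorphic (abelianisation G) ZxZ)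
    (large G)
  /\ ((exists H : groupClosed G, finite_index H /\
         ~ isomorphic (abelianisation (subgroup H)) ZxZ) ->
      large G).
Proof.
have [pi [pi_surj pi_ker]] := presents_epi presG.
have [k0 [u [v Rk0]]] := commR.
have iso_ab : isomorphic G ZxZ -> abelian_group G.
  move=> [f f_bij] x y; apply: (bij_inj f_bij).
  by rewrite !gmulfM; apply: ZxZ_abelian.
have ab_not_large : abelian_group G -> ~ large G.
  move=> abG /large_commutator [H [x [y [_ /negP]]]]; apply.
  by have /commgP/eqP -> := abG x y; apply: gpred1.
split; last first.
  move=> [H [fiH niso]]; apply: contrapT => nl; apply: niso.
  exact: (not_large_finite_index pi_surj pi_ker Rk0 nl fiH).
have [lG|nl] := pselect (large G).
  apply: Or33; split=> //; first by move=> /iso_ab /ab_not_large.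
  move=> [[_ ra] _]; have [H [x [y [fiH /negP]]]] := large_commutator lG; apply.
  have xyD : [set` derived_subgroup G] [~ x, y] := commg_derived x y.
  by rewrite -ra in xyD; apply: xyD.
have isoab := not_large_abelianisation pi_surj pi_ker Rk0 nl.
have [abG|nab] := pselect (abelian_group G).
  apply: Or31; split=> //; first exact: isomorphic_abelianisation.
  by move=> [[]].
apply: Or32; split=> //; first by move/iso_ab.
split=> //; split=> //.
exact: (not_large_RA pi_surj pi_ker Rk0 nl).
Qed.
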